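(* Let $(V,\cdot,\langle\cdot,\cdot\rangle)$ be a non asymmetric Courant algebroid on a connected smooth manifold $M$. If $H^2(V_x,V_x)=0$ for all $x\in M$, then the Koszul-Vinberg algebra bundle $(V,\cdot)$ is locally trivial.
   Context: $M$ is a connected smooth manifold, $F(M)=C^\infty(M,\mathbb R)$, $V$ is a smooth real vector bundle on $M$, and $\Gamma(V)$ is its space of smooth sections. A Koszul-Vinberg algebra is a real algebra $A$ with $a(bc)-(ab)c=b(ac)-(ba)c$ for all $a,b,c\in A$. A non asymmetric Courant algebroid written as a triple $(V,\cdot,\langle\cdot,\cdot\rangle)$ (i.e. with anchor $\rho=0$ and 1-cocycle $D=0$) is a Koszul-Vinberg algebra bundle with an invariant form: $\Gamma(V)$ carries an $F(M)$-bilinear multiplication $(s,s')\mapsto ss'$ making it a Koszul-Vinberg algebra, and $\langle\cdot,\cdot\rangle$ is a (smooth, fiberwise) non degenerate symmetric bilinear form on $V$ with $\langle ss',s''\rangle+\langle s',ss''\rangle=0$ for all $s,s',s''\in\Gamma(V)$. Each fiber $V_x$ is a Koszul-Vinberg algebra with $s(x)\cdot s'(x)=(ss')(x)$. Koszul-Vinberg cohomology: for a real Koszul-Vinberg algebra $A$ and $k\ge1$, $C^k(A,A)=\operatorname{Hom}_{\mathbb R}(A^{\otimes k},A)$, with coboundary $\delta:C^k(A,A)\to C^{k+1}(A,A)$, $$\delta\Theta(a_1,\dots,a_{k+1})=\sum_{j=1}^{k}(-1)^j\Big((a_j\Theta)(a_1,\dots,\hat a_j,\dots,a_{k+1})+\big(\Theta(a_1,\dots,\hat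 a_j,\dots,a_k,a_j)\big)a_{k+1}\Big),$$ where $(a\Theta)(b_1,\dots,b_k)=a\,\Theta(b_1,\dots,b_k)-\sum_{r=1}^k\Theta(b_1,\dots,ab_r,\dots,b_k)$. $H^2(A,A)$ is the space of $2$-cocycles modulo $\delta C^1(A,A)$; $H^2(V_x,V_x)$ is this space for $A=V_x$. $(V,\cdot)$ is locally trivial if each point of $M$ has an open neighborhood $U$, a Koszul-Vinberg algebra $A$, and a smooth vector bundle isomorphism $V|_U\to U\times A$ that is an algebra isomorphism $V_x\to A$ for each $x\in U$. *)

(* Defs.v *)
From HB Require Import structures.
From mathcomp Require Import all_boot all_order all_algebra.
From mathcomp Require Import all_classical all_reals all_analysis.
Import Order.TTheory GRing.Theory Num.Theory.
Import numFieldNormedType.Exports.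

Set Implicit Arguments.
Unset Strict Implicit.
Unset Printing Implicit Defensive.

Local Open Scope classical_set_scope.
Local Open Scope ring_scope.

Section KoszulVinberg.
Variables (R : realType) (A : lmodType R).

Record kv_algebra := KVAlgebra {
  kv_mul :> {bilinear A -> A -> A};
  kv_law : forall a b c : A,
    kv_mul a (kv_mul b c) - kv_mul (kv_mul a b) c =
    kv_mul b (kv_mul a c) - kv_mul (kv_mul b a) c
}.

(* Elements of Hom(A^{\otimes k}, A) are the multilinear maps A^k -> A. *)
Definition cochain (k : nat) := ('I_k -> A) -> A.

Definition multilinear k (Theta : cochain k) : Prop :=
  forall (a : 'I_k -> A) (i : 'I_k),
    linear (fun v : A => Theta [eta a with i |-> v]).

Variable mu : kv_algebra.

Definition kv_act k (a : A) (Theta : cochain k) : cochain k := fun b =>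
  mu a (Theta b) - \sum_(r < k) Theta [eta b with r |-> mu a (b r)].

(* Indices are shifted by one with respect to a_1, ..., a_(k+1): the summation
   index j < k stands for j + 1, and [lift j' i] enumerates the indices other
   than j. Its last value, at i = k - 1, is the index k of a_(k+1); it is
   replaced by a_j in the second term. *)
Definition coboundary k (Theta : cochain k) : cochain k.+1 := fun a =>
  \sum_(j < k) let j' : 'I_k.+1 := widen_ord (leqnSn k) j in
    (-1) ^+ j.+1 *:
      (kv_act (a j') Theta (fun i : 'I_k => a (lift j' i))
       + mu (Theta (fun i : 'I_k => if i.+1 == k then a j' else a (lift j' i)))
            (a ord_max)).

Definition cocycle k : set (cochain k) :=
  [set Theta | multilinear Theta /\ forall a, coboundary Theta a = 0].

Definition cohomology_class k (Theta : cochain k.+1) : set (cochain k.+1) :=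
  [set Theta' | exists2 Phi : cochain k, multilinear Phi &
    forall a, Theta' a = Theta a + coboundary Phi a].

(* H^2(A, A), as the set of cosets of \delta C^1(A, A) in the 2-cocycles. *)
Definition H2 : set (set (cochain 2)) := @cohomology_class 1 @` @cocycle 2%N.

Definition H2_eq0 : Prop := H2 = [set @cohomology_class 1 (fun=> 0)].

End KoszulVinberg.

Section SmoothMaps.
Variables (R : realType) (E F : normedModType R).

Fixpoint Ck_on (k : nat) (O : set E) (f : E -> F) : Prop :=
  if k is k'.+1 then
    (forall x, O x -> differentiable f x) /\
    (forall v : E, Ck_on k' O (fun x => 'd f x v))
  else forall x, O x -> {for x, continuous f}.

Definition smooth_on (O : set E) (f : E -> F) : Prop :=
  forall k, Ck_on k O f.

End SmoothMaps.

Section Manifolds.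
Variables (R : realType) (n : nat) (M : topologicalType).

(* A homeomorphism from the open set [ch_dom] onto the open set [ch_cod];
   the two functions are irrelevant outside these sets. *)
Record chart := Chart {
  ch_dom : set M;
  ch_cod : set 'rV[R]_n;
  ch_map : M -> 'rV[R]_n;
  ch_inv : 'rV[R]_n -> M;
  ch_dom_open : open ch_dom;
  ch_cod_open : open ch_cod;
  ch_map_cod : forall x, ch_dom x -> ch_cod (ch_map x);
  ch_inv_dom : forall u, ch_cod u -> ch_dom (ch_inv u);
  ch_mapK : forall x, ch_dom x -> ch_inv (ch_map x) = x;
  ch_invK : forall u, ch_cod u -> ch_map (ch_inv u) = u;
  ch_map_cont : {within ch_dom, continuous ch_map};
  ch_inv_cont : {within ch_cod, continuous ch_inv}
}.

Record smooth_structure := SmoothStructure {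
  atlas : set chart;
  sm_hausdorff : hausdorff_space M;
  sm_second_countable : @second_countable M;
  atlas_cover : forall x, exists2 c, atlas c & ch_dom c x;
  atlas_compat : forall c c', atlas c -> atlas c' ->
    smooth_on (ch_cod c `&` ch_inv c @^-1` ch_dom c') (ch_map c' \o ch_inv c)
}.

Variable X : smooth_structure.

Definition smooth_map_on (W : normedModType R) (O : set M) (f : M -> W) : Prop :=
  forall c, atlas X c ->
    smooth_on (ch_cod c `&` ch_inv c @^-1` O) (f \o ch_inv c).

Variable r : nat.

(* A fibrewise linear bijection V|_U -> U x R^r, over an open set U. *)
Record local_triv (V : M -> lmodType R) := LocalTriv {
  lt_dom : set M;
  lt_map : forall x, V x -> 'rV[R]_r;
  lt_inv : forall x, 'rV[R]_r -> V x;
  lt_dom_open : open lt_dom;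
  lt_linear : forall x, lt_dom x -> linear (@lt_map x);
  lt_mapK : forall x, lt_dom x -> cancel (@lt_map x) (@lt_inv x);
  lt_invK : forall x, lt_dom x -> cancel (@lt_inv x) (@lt_map x)
}.

(* Smoothness of (x, w) |-> (x, s_x (t_x^-1 w)) on (U_t `&` U_s) x R^r; being
   linear in w, it amounts to smoothness in x for each fixed w. *)
Definition triv_smooth V (t s : local_triv V) : Prop :=
  forall w : 'rV[R]_r,
    smooth_map_on (lt_dom t `&` lt_dom s) (fun x => lt_map s (lt_inv t x w)).

Record vector_bundle := VectorBundle {
  vb_fiber :> M -> lmodType R;
  vb_atlas : set (local_triv vb_fiber);
  vb_cover : forall x, exists2 t, vb_atlas t & lt_dom t x;
  vb_compat : forall t s, vb_atlas t -> vb_atlas s -> triv_smooth t s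
}.

(* A smooth vector bundle isomorphism V|_U -> U x R^r, U = lt_dom s. *)
Definition smooth_triv (V : vector_bundle) (s : local_triv V) : Prop :=
  forall t, vb_atlas t -> triv_smooth t s /\ triv_smooth s t.

Definition smooth_section (V : vector_bundle) (s : forall x, V x) : Prop :=
  forall t, vb_atlas t -> smooth_map_on (lt_dom t) (fun x => lt_map t (s x)).

Definition smooth_function (f : M -> R) : Prop :=
  smooth_map_on (W := R^o) setT f.

(* Non asymmetric Courant algebroids with zero anchor and zero 1-cocycle. The
   multiplication [na_mul] of sections is only relevant on smooth sections; the
   fibre products [na_fiber x] are determined by it through [na_fiberE]. *)
Record na_courant (V : vector_bundle) := NACourant {
  na_mul : (forall x, V x) -> (forall x, V x) -> forall x, V x;
  na_mul_smooth : forall s s', smooth_section s -> smooth_section s' ->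
    smooth_section (na_mul s s');
  na_mul_linearl : forall f s1 s2 s', smooth_function f ->
    smooth_section s1 -> smooth_section s2 -> smooth_section s' ->
    forall x, na_mul (fun y => f y *: s1 y + s2 y) s' x =
              f x *: na_mul s1 s' x + na_mul s2 s' x;
  na_mul_linearr : forall f s s1 s2, smooth_function f ->
    smooth_section s -> smooth_section s1 -> smooth_section s2 ->
    forall x, na_mul s (fun y => f y *: s1 y + s2 y) x =
              f x *: na_mul s s1 x + na_mul s s2 x;
  na_mul_kv : forall a b c, smooth_section a -> smooth_section b ->
    smooth_section c -> forall x,
    na_mul a (na_mul b c) x - na_mul (na_mul a b) c x =
    na_mul b (na_mul a c) x - na_mul (na_mul b a) c x;
  na_fiber : forall x, kv_algebra (V x);
  na_fiberE : forall s s', smooth_section s -> smooth_section s' ->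
    forall x, na_fiber x (s x) (s' x) = na_mul s s' x;
  na_form : forall x, {biscalar V x};
  na_form_smooth : forall s s', smooth_section s -> smooth_section s' ->
    smooth_function (fun x => na_form x (s x) (s' x));
  na_form_sym : forall x (v w : V x), na_form x v w = na_form x w v;
  na_form_nondeg : forall x (v : V x),
    (forall w, na_form x v w = 0) -> v = 0;
  na_form_inv : forall s s' s'', smooth_section s -> smooth_section s' ->
    smooth_section s'' -> forall x,
    na_form x (na_mul s s' x) (s'' x) + na_form x (s' x) (na_mul s s'' x) = 0
}.

(* The typical fibre A is finite-dimensional, of dimension r, hence is taken to
   be R^r with some Koszul-Vinberg product. *)
Definition locally_trivial (V : vector_bundle) (C : na_courant V) : Prop :=
  forall x : M, exists (s : local_triv V) (A : kv_algebra 'rV[R]_r),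
    [/\ lt_dom s x, smooth_triv s &
        forall y, lt_dom s y -> forall v w : V y,
          lt_map s (na_fiber C y v w) = A (lt_map s v) (lt_map s w)].

End Manifolds.

(* Main.v *)
From HB Require Import structures.
Require Import Defs.
From mathcomp Require Import all_boot all_order all_algebra.
From mathcomp Require Import all_classical all_reals all_analysis.
From mathcomp Require Import ring lra.
Import Order.TTheory GRing.Theory Num.Theory.
Import numFieldNormedType.Exports.

Set Implicit Arguments.
Unset Strict Implicit.
Unset Printing Implicit Defensive.

Local Open Scope classical_set_scope.
Local Open Scope ring_scope.

(** The statement is an instance of the rigidity principle of Nijenhuis and
    Richardson: the vanishing of H^2 at one point x0 forces the nearby fibres
    to be isomorphic to the fibre at x0, by an isomorphism that can be chosen
    smoothly.

    In a trivialization of V around x0 the fibre products become products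
    [mu_x] on R^r, recorded by structure matrices [bil]. An invertible matrix h
    is an isomorphism from [mu] to [mu0 = mu_x0] when the defect
    [F(mu, h)(a, b) = mu(a, b) h - mu0(a h, b h)] vanishes ([morphism_defect]).
    Two linear maps govern F near [(mu0, 1)].
    - Its derivative in h is the coboundary A from 1-cochains to 2-cochains
      ([defect_d1]).
    - Whenever mu and mu0 are both Koszul-Vinberg, F(mu, h) satisfies a linear
      equation [F B(mu, h) = 0] exactly, where [B(mu, h)] is a twisted form of
      the coboundary on 2-cochains and equals it, up to sign, at [(mu0, 1)]
      ([morphism_defect_cocycle]).

    With [B = B(mu0, 1)], the hypothesis H^2 = 0 says that the kernel of B is
    the image of A, hence that there are S and T with [B T + S A = 1] and
    [S A S = S], operators acting on row vectors on the right
    ([splitting_of_exactness]). The equation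
    [F(mu, 1 + eta) S = 0] is solved with the implicit function theorem: after
    adding the part [eta - eta A S] to it, it has the form
    [eta = quadratic expression in (mu - mu0, eta)], which is a contraction near
    0 ([quad_solution]) and has a solution depending smoothly on mu
    ([quad_smooth]). For this h, F is killed by S and by [B(mu, h)], so that
    [F = F (B T + S A) = F (B - B(mu, h)) T]; as [B(mu, h)] is close to B, F is
    zero ([splitting_perturb], [rigid_product]).

    It remains to see that [mu_x] is smooth in x ([fibre_mx_smooth]). Only
    products of globally defined smooth sections are known to be smooth, so the
    frame of the trivialization is multiplied by a bump function built from
    exp(-1/t), and the product of two such sections is divided by the square of
    the bump function where the latter does not vanish. *)

(** * Calculus of C^k maps *)

Section CkCalculus.
Variables (R : realType) (E : normedModType R).
Implicit Types (F : normedModType R) (k : nat) (O : set E).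

Lemma Ck_cont F k O (f : E -> F) x : Ck_on k O f -> O x -> {for x, continuous f}.
Proof.
case: k => [|k] /= Cf Ox; first exact: Cf.
exact: (differentiable_continuous (Cf.1 x Ox)).
Qed.

Lemma CkW F k O (f : E -> F) : Ck_on k.+1 O f -> Ck_on k O f.
Proof.
elim: k f => [|k IH] f /= [df Cf].
  by move=> x Ox; exact: (differentiable_continuous (df x Ox)).
by split=> // v; exact/IH/Cf.
Qed.

Lemma Ck_subset F k O O' (f : E -> F) : O' `<=` O -> Ck_on k O f -> Ck_on k O' f.
Proof.
move=> sO; elim: k f => [|k IH] f /= Cf; first by move=> x /sO /Cf.
by split=> [x /sO /(Cf.1 x)|v]; [|exact: IH (Cf.2 v)].
Qed.

Lemma CkU F k O O' (f : E -> F) :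
  Ck_on k O f -> Ck_on k O' f -> Ck_on k (O `|` O') f.
Proof.
elim: k f => [|k IH] f /=; first by move=> H H' x [/H|/H'].
move=> [df Cf] [df' Cf']; split; first by move=> x [/df|/df'].
by move=> v; exact: IH.
Qed.

(** Differentials are germ-local. Through [Ck_ext] this lets every formula for a
    derivative below be checked on an open set only, whatever the maps do
    elsewhere. *)
Lemma near_eq_diff F (f g : E -> F) x : (\near x, f x = g x) ->
  differentiable f x -> differentiable g x /\ 'd g x = 'd f x :> (E -> F).
Proof.
move=> fg df; have fgx := nbhs_singleton fg.
have gE : g \o shift x = cst (g x) + 'd f x +o_ 0 id.
  apply/eqaddoP => e e0; have := diff_locally df.
  move/eqaddoP => /(_ e e0).
  move: (fg); rewrite (near_shift 0 x) subr0.
  apply: filterS2 => h /= fgh.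
  by rewrite !fctE /= fgh fgx.
have dE : 'd g x = 'd f x :> (E -> F).
  by apply: diff_unique => //; exact: diff_continuous.
split=> //; apply/diff_locallyP; rewrite dE; split; first exact: diff_continuous.
exact: gE.
Qed.

Lemma Ck_ext F k O (f g : E -> F) : open O -> (forall x, O x -> f x = g x) ->
  Ck_on k O f -> Ck_on k O g.
Proof.
move=> oO; elim: k f g => [|k IH] f g fg.
  move=> Cf x Ox; have := Cf x Ox; rewrite /prop_for /continuous_at -(fg x Ox).
  apply: cvg_trans; apply: near_eq_cvg; near=> y; apply/fg; near: y.
  exact: open_nbhs_nbhs.
have fgn x : O x -> \near x, f x = g x.
  by move=> Ox; near=> y; apply/fg; near: y; exact: open_nbhs_nbhs.
move=> [df Cf]; split=> [x Ox|v].
  by have [] := near_eq_diff (fgn x Ox) (df x Ox).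
by apply: IH (Cf v) => x Ox; have [_ ->] := near_eq_diff (fgn x Ox) (df x Ox).
Unshelve. all: by end_near. Qed.

Lemma Ck_cst F k O (a : F) : Ck_on k O (fun _ : E => a).
Proof.
elim: k a => [|k IH] a /=; first by move=> x _; exact: cst_continuous.
split=> [x _|v]; first exact: differentiable_cst.
have -> : (fun x => 'd (fun=> a) x v) = fun=> 0; last exact: IH.
by apply/funext => x; rewrite [X in X _ = _](diff_cst a x).
Qed.

Lemma Ck_id k O : Ck_on k O (id : E -> E).
Proof.
have cid : continuous (idfun : {linear E -> E}) by move=> x; exact: cvg_id.
case: k => [|k] /=; first by move=> x _; exact: cvg_id.
split=> [x _|v]; first exact: (linear_differentiable x cid).
rewrite (_ : (fun x => _) = fun=> v); first exact: Ck_cst.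
by apply/funext => x; rewrite (diff_lin x cid).
Qed.

Section Closure.
Variables (O : set E).
Hypothesis oO : open O.

Lemma CkD F k (f g : E -> F) :
  Ck_on k O f -> Ck_on k O g -> Ck_on k O (fun x => f x + g x).
Proof.
elim: k f g => [|k IH] f g /=.
  by move=> Cf Cg x Ox; apply: continuousD; [exact: Cf|exact: Cg].
move=> [df Cf] [dg Cg]; split=> [x Ox|v].
  exact: differentiableD (df x Ox) (dg x Ox).
apply: (@Ck_ext _ _ _ (fun x => 'd f x v + 'd g x v)) => //; last exact: IH.
by move=> x Ox; rewrite [in RHS](diffD (df x Ox) (dg x Ox)).
Qed.

Lemma Ck_lin F (G : normedModType R) k (l : {linear F -> G}) (f : E -> F) :
  continuous l -> Ck_on k O f -> Ck_on k O (fun x => l (f x)).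
Proof.
move=> cl; elim: k f => [|k IH] f /=.
  move=> Cf x Ox; apply: (@continuous_comp _ _ _ f l); first exact: Cf.
  exact: cl.
move=> [df Cf]; split=> [x Ox|v].
  by apply: differentiable_comp (df x Ox) _; exact: linear_differentiable.
apply: (@Ck_ext _ _ _ (fun x => l ('d f x v))) => //; last exact: IH.
move=> x Ox; rewrite [in RHS](@diff_comp _ _ _ _ f l); first last.
- exact: linear_differentiable.
- exact: df.
by rewrite diff_lin.
Qed.

(** The differential b(f, dg) + b(df, g) is a sum of two expressions of the same
    shape, one order of differentiability below: this drives the induction. *)
Lemma Ck_bilin F (G H : normedModType R) k (b : {bilinear F -> G -> H})
    (f : E -> F) (g : E -> G) :
  continuous (fun p => b p.1 p.2) ->
  Ck_on k O f -> Ck_on k O g -> Ck_on k O (fun x => b (f x) (g x)).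
Proof.
move=> cb; elim: k f g => [|k IH] f g.
  move=> /= Cf Cg x Ox; apply: (@continuous_comp _ _ _ (fun x => (f x, g x))
    (fun p => b p.1 p.2)); last exact: cb.
  by apply: cvg_pair; [exact: Cf|exact: Cg].
move=> /[dup] /CkW Wf [df Cf] /[dup] /CkW Wg [dg Cg].
pose p x := (f x, g x); pose bp := fun q : F * G => b q.1 q.2.
split=> [x Ox|v].
  apply: (@differentiable_comp _ _ _ _ p bp).
    by apply: differentiable_pair; [exact: df|exact: dg].
  exact: differentiable_bilin.
apply: (@Ck_ext _ _ _ (fun x => b (f x) ('d g x v) + b ('d f x v) (g x))) => //.
  move=> x Ox; rewrite [in RHS](@diff_comp _ _ _ _ p bp); first last.
  - exact: differentiable_bilin.
  - by apply: differentiable_pair; [exact: df|exact: dg].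
  have := diff_pair (df x Ox) (dg x Ox); rewrite -/p => pE.
  by rewrite /= /bp diff_bilin//= pE.
by apply: CkD; [exact: (IH _ _ Wf (Cg v))|exact: (IH _ _ (Cf v) Wg)].
Qed.

Lemma Ck_sum F k (I : Type) (s : seq I) (P : pred I) (f : I -> E -> F) :
  (forall i, P i -> Ck_on k O (f i)) ->
  Ck_on k O (fun x => \sum_(i <- s | P i) f i x).
Proof.
move=> Cf; elim: s => [|i s IH].
  rewrite (_ : (fun x => _) = fun=> 0); first exact: Ck_cst.
  by apply/funext => x; rewrite big_nil.
rewrite (_ : (fun x => _) = fun x => if P i then f i x + \sum_(j <- s | P j) f j x
  else \sum_(j <- s | P j) f j x); last by apply/funext => x; rewrite big_cons.
by case Pi: (P i) => //; apply: CkD => //; exact: Cf.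
Qed.

Lemma scale_continuous F : continuous (fun p : R^o * F => p.1 *: p.2).
Proof. by move=> p; apply: cvgZ; [exact: cvg_fst|exact: cvg_snd]. Qed.

Lemma scale_bilinear F : bilinear_for
  (GRing.Scale.Law.clone _ _ *:%R _) (GRing.Scale.Law.clone _ _ *:%R _)
  (fun (a : R^o) (v : F) => a *: v).
Proof.
split=> [v a b c|a c u v] /=; first by rewrite scalerDl scalerA.
by rewrite scalerDr !scalerA mulrC.
Qed.

Lemma CkZ F k (a : E -> R^o) (f : E -> F) :
  Ck_on k O a -> Ck_on k O f -> Ck_on k O (fun x => (a x : R) *: f x).
Proof.
pose bM := bilinear_isBilinear.Build R R^o F F _ _
  (fun (a : R^o) (v : F) => a *: v) (@scale_bilinear F).
pose b : {bilinear R^o -> F -> F} := HB.pack (fun (a : R^o) (v : F) => a *: v) bM.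
exact: (@Ck_bilin _ _ _ _ b a f (@scale_continuous F)).
Qed.

Lemma CkB F k (f g : E -> F) :
  Ck_on k O f -> Ck_on k O g -> Ck_on k O (fun x => f x - g x).
Proof.
move=> Cf Cg; have -> : (fun x => f x - g x) = (fun x => f x + (-1 : R) *: g x).
  by apply/funext => x; rewrite scaleN1r.
by apply: CkD => //; apply: CkZ => //; exact: Ck_cst.
Qed.

Lemma CkM k (a b : E -> R^o) :
  Ck_on k O a -> Ck_on k O b -> Ck_on k O (fun x => (a x : R) * b x : R^o).
Proof. exact: CkZ. Qed.

Lemma Ck_prod k (I : Type) (s : seq I) (f : I -> E -> R^o) :
  (forall i, Ck_on k O (f i)) ->
  Ck_on k O (fun x => \prod_(i <- s) (f i x : R) : R^o).
Proof.
move=> Cf; elim: s => [|i s IH].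
  rewrite (_ : (fun x => _) = fun=> 1); first exact: Ck_cst.
  by apply/funext => x; rewrite big_nil.
rewrite (_ : (fun x => _) = fun x => f i x * \prod_(j <- s) f j x).
  exact: CkM.
by apply/funext => x; rewrite big_cons.
Qed.

(** The differential - a^-2 da only involves the inverse at a lower order. *)
Lemma CkV k (a : E -> R^o) : (forall x, O x -> a x != 0) ->
  Ck_on k O a -> Ck_on k O (fun x => (a x : R)^-1 : R^o).
Proof.
move=> a0; elim: k => [|k IH].
  by move=> /= Ca x Ox; apply: cvgV; [exact: a0|exact: Ca].
move=> /[dup] /CkW Wa [da Ca]; have Va := IH Wa.
split=> [x Ox|v]; first exact: (differentiableV (da x Ox) (a0 x Ox)).
apply: (@Ck_ext _ _ _ (fun x => - ((a x : R)^-1 * (a x)^-1 * 'd a x v))) => //.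
  move=> x Ox; rewrite [in RHS](diffV (da x Ox) (a0 x Ox)) /=.
  by rewrite -expr2 exprVn scaleNr.
have -> : (fun x => - ((a x : R)^-1 * (a x)^-1 * 'd a x v)) =
          (fun x => (-1 : R) *: ((a x : R)^-1 * (a x)^-1 * 'd a x v : R^o)).
  by apply/funext => x; rewrite scaleN1r.
apply: CkZ; first exact: Ck_cst.
by apply: CkM; [exact: CkM|exact: Ca].
Qed.

End Closure.
End CkCalculus.

(** * Matrix-valued maps *)

Section MatrixMaps.
Variable R : realType.

Lemma continuous_sum (T : topologicalType) (F : normedModType R) (I : Type)
    (s : seq I) (P : pred I) (f : I -> T -> F) :
  (forall i, P i -> continuous (f i)) ->
  continuous (fun x => \sum_(i <- s | P i) f i x).
Proof. exact/continuous_big/add_continuous. Qed.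

(** Finite dimension enters here: continuity is automatic because the value is a
    finite sum of coordinates times constants. *)
Lemma mx_lin_continuous m n (F : normedModType R) (l : {linear 'M[R]_(m, n) -> F}) :
  continuous l.
Proof.
have -> : (l : _ -> _) = fun A => \sum_i \sum_j (A i j *: l (delta_mx i j)).
  apply/funext => A; rewrite {1}(matrix_sum_delta A) linear_sum.
  apply: eq_bigr => i _; rewrite linear_sum; apply: eq_bigr => j _.
  by rewrite linearZ.
apply: continuous_sum => i _; apply: continuous_sum => j _ A.
exact: cvgZr_tmp (@coord_continuous R m n i j A).
Qed.

Lemma mx_bilin_continuous m n m' n' (F : normedModType R)
    (b : {bilinear 'M[R]_(m, n) -> 'M[R]_(m', n') -> F}) :
  continuous (fun p => b p.1 p.2).
Proof.
have -> : (fun p => b p.1 p.2) =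
   fun p => \sum_i \sum_j (p.1 i j *: b (delta_mx i j) p.2).
  apply/funext => p; rewrite {1}(matrix_sum_delta p.1) linear_sumlz.
  apply: eq_bigr => i _; rewrite linear_sumlz; apply: eq_bigr => j _.
  by rewrite linearZl_LR.
apply: continuous_sum => i _; apply: continuous_sum => j _ p.
apply: cvgZ.
  apply: (@continuous_comp _ _ _ fst (fun A : 'M[R]_(m, n) => A i j)).
    exact: cvg_fst.
  exact: coord_continuous.
apply: (@continuous_comp _ _ _ snd (b (delta_mx i j))); first exact: cvg_snd.
exact: mx_lin_continuous.
Qed.

Variable (E : normedModType R).
Variables (O : set E).
Hypothesis oO : open O.

Lemma Ck_mxlin m n (F : normedModType R) k (l : {linear 'M[R]_(m, n) -> F})
    (f : E -> 'M[R]_(m, n)) :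
  Ck_on k O f -> Ck_on k O (fun x => l (f x)).
Proof. by apply: Ck_lin => //; exact: mx_lin_continuous. Qed.

Lemma Ck_mxbilin m n m' n' (F : normedModType R) k
    (b : {bilinear 'M[R]_(m, n) -> 'M[R]_(m', n') -> F})
    (f : E -> 'M[R]_(m, n)) (g : E -> 'M[R]_(m', n')) :
  Ck_on k O f -> Ck_on k O g -> Ck_on k O (fun x => b (f x) (g x)).
Proof. by apply: Ck_bilin => //; exact: mx_bilin_continuous. Qed.

Lemma Ck_mulmx m n p k (f : E -> 'M[R]_(m, n)) (g : E -> 'M[R]_(n, p)) :
  Ck_on k O f -> Ck_on k O g -> Ck_on k O (fun x => f x *m g x).
Proof.
exact: (@Ck_mxbilin _ _ _ _ _ k
  (mulmx : {bilinear 'M[R]_(m, n) -> 'M[R]_(n, p) -> 'M[R]_(m, p)})).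
Qed.

Lemma Ck_entry m n k (f : E -> 'M[R]_(m, n)) i j :
  Ck_on k O f -> Ck_on k O (fun x => f x i j : R^o).
Proof.
pose c (A : 'M[R]_(m, n)) : R^o := A i j.
have cl : linear c by move=> a u v; rewrite /c !mxE.
pose cM := GRing.isLinear.Build _ _ _ _ _ cl.
pose cL : {linear _ -> _} := HB.pack c cM.
exact: (@Ck_mxlin _ _ _ k cL).
Qed.

Lemma Ck_mx m n k (f : E -> 'M[R]_(m, n)) :
  (forall i j, Ck_on k O (fun x => f x i j : R^o)) -> Ck_on k O f.
Proof.
move=> Cf; have -> : f = fun x => \sum_i \sum_j (f x i j *: delta_mx i j).
  by apply/funext => x; rewrite {1}(matrix_sum_delta (f x)).
apply: Ck_sum => // i _; apply: Ck_sum => // j _.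
by apply: CkZ => //; exact: Ck_cst.
Qed.

Lemma Ck_det n k (f : E -> 'M[R]_n) :
  Ck_on k O f -> Ck_on k O (fun x => \det (f x) : R^o).
Proof.
move=> Cf; apply: Ck_sum => // s _; apply: CkM => //; first exact: Ck_cst.
by apply: Ck_prod => // i; exact: Ck_entry.
Qed.

(** Cramer's formula makes the inverse rational in the entries. *)
Lemma Ck_invmx n k (f : E -> 'M[R]_n) : (forall x, O x -> f x \in unitmx) ->
  Ck_on k O f -> Ck_on k O (fun x => invmx (f x)).
Proof.
move=> fU Cf; apply: (@Ck_ext _ _ _ _ _ (fun x => (\det (f x))^-1 *: \adj (f x))).
- exact: oO.
- by move=> x Ox; rewrite /invmx fU.
apply: CkZ => //.
  apply: CkV => //; last exact: Ck_det.
  by move=> x Ox; have := fU x Ox; rewrite unitmxE unitfE.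
apply: Ck_mx => i j.
have -> : (fun x => (\adj (f x)) i j : R^o) = (fun x => cofactor (f x) j i : R^o).
  by apply/funext => x; rewrite mxE.
apply: CkM => //; first exact: Ck_cst.
apply: Ck_det; apply: Ck_mx => a b.
have -> : (fun x => (row' j (col' i (f x))) a b : R^o) =
  (fun x => f x (lift j a) (lift i b) : R^o).
  by apply/funext => x; rewrite !mxE.
exact: Ck_entry.
Qed.

End MatrixMaps.

Section Caratheodory.
Variables (R : realType) (E : normedModType R).

Lemma mulmx_bound m n p : exists2 k, k > 0 &
  forall (A : 'M[R]_(m, n)) (B : 'M[R]_(n, p)), `|A *m B| <= k * `|A| * `|B|.
Proof. exact/bilinear_schwarz/mx_bilin_continuous. Qed.

(** Caratheodory's form of differentiability: an increment of f that is an
    increment of g times a continuous factor has the differential of g times the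
    value of that factor. It turns an exact identity between increments into a
    derivative, which is how implicitly defined maps are differentiated below.
*)
Lemma caratheodory_diff p m (f : E -> 'rV[R]_m) (g : E -> 'rV[R]_p)
    (A : E -> 'M[R]_(p, m)) (x : E) :
  (\forall y \near x, f y - f x = (g y - g x) *m A y) ->
  differentiable g x -> {for x, continuous A} ->
  differentiable f x /\ 'd f x = (fun v => 'd g x v *m A x) :> (E -> _).
Proof.
move=> fgA dg cA; pose L v := 'd g x v *m A x.
have Ll : linear L by move=> a u v; rewrite /L linearP mulmxDl scalemxAl.
pose LM := GRing.isLinear.Build _ _ _ _ _ Ll.
pose LL : {linear _ -> _} := HB.pack L LM.
have cdg : continuous 'd g x by exact: diff_continuous.
have cL : continuous LL.
  move=> v; apply: (@continuous_comp _ _ _ ('d g x) (fun w => w *m A x)).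
    exact: cdg.
  exact: (@mx_lin_continuous R 1 p _ (mulmxr (A x) : {linear 'rV[R]_p -> 'rV[R]_m})).

have [k k0 kP] := mulmx_bound 1 p m.
have [K K0 KP] := linear_lipschitz cdg.
have fE : f \o shift x = cst (f x) + LL +o_ 0 id.
  apply/eqaddoP => e e0.
  pose e1 := e / 2 / (k * (`|A x| + 1)).
  pose e2 := e / 2 / (k * (K + 1)).
  have Ax0 : 0 < `|A x| + 1 by rewrite ltr_wpDl.
  have e10 : 0 < e1 by rewrite !divr_gt0 ?mulr_gt0.
  have e20 : 0 < e2 by rewrite !divr_gt0 ?mulr_gt0 ?addr_gt0.
  have /eqaddoP dgP := diff_locally dg.
  move: (fgA); rewrite (near_shift 0 x) subr0 => fgA'.
  have : \forall y \near x, `|A x - A y| <= e2.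
    by move/cvgrPdist_le : cA; exact.
  rewrite (near_shift 0 x) subr0 => cA'.
  have dg1 := dgP _ e10; have dg2 := dgP _ ltr01.
  near=> h.
  have hA : f (h + x) - f x = (g (h + x) - g x) *m A (h + x) by near: h.
  have hc : `|A x - A (h + x)| <= e2 by near: h.
  have h1 : `|g (h + x) - (g x + 'd g x h)| <= e1 * `|h| by near: h.
  have h2 : `|g (h + x) - (g x + 'd g x h)| <= 1 * `|h| by near: h.
  rewrite !fctE /= opprD addrA hA.
  have -> : (g (h + x) - g x) *m A (h + x) - L h =
     (g (h + x) - (g x + 'd g x h)) *m A x
     - (g (h + x) - (g x + 'd g x h) + 'd g x h) *m (A x - A (h + x)).
    rewrite opprD addrA subrK /L mulmxBr [in RHS]mulmxBl.
    by rewrite opprB [RHS]addrC addrA subrK.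
  rewrite (splitr e) mulrDl (le_trans (ler_normB _ _))// lerD//.
    apply: le_trans (kP _ _) _.
    rewrite (le_trans (y := k * (e1 * `|h|) * (`|A x| + 1)))//.
      by rewrite ler_pM ?mulr_ge0 ?ler_wpM2l ?lerDl// ltW.
    by rewrite /e1 le_eqVlt; apply/orP; left; apply/eqP; field; rewrite !gt_eqF.
  apply: le_trans (kP _ _) _.
  rewrite (le_trans (y := k * ((K + 1) * `|h|) * e2))//.
    rewrite ler_pM ?mulr_ge0 ?ler_wpM2l//; [exact: ltW|exact: ltW|].
    rewrite (le_trans (ler_normD _ _))// mulrDl addrC lerD//.
  by rewrite /e2 le_eqVlt; apply/orP; left; apply/eqP; field;
     rewrite !gt_eqF ?addr_gt0.
have dE : 'd f x = LL :> (E -> _) by exact: diff_unique cL fE.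
by split=> //; apply/diff_locallyP; rewrite dE.
Unshelve. all: by end_near. Qed.

End Caratheodory.

(** * Quadratic fixed-point equations *)

(** Joins completeness with the norm on matrices, so that the Banach fixed-point
    theorem applies to them. *)
HB.instance Definition _ (K : realType) m n :=
  Complete.copy 'M[K]_(m, n) 'M[K]_(m, n).

Section QuadraticEquation.
Variables (R : realType) (p m : nat).
Variables (S : 'M[R]_(p, m)) (b1 : {bilinear 'rV[R]_p -> 'rV[R]_m -> 'rV[R]_m})
  (b2 : {bilinear 'rV[R]_m -> 'rV[R]_m -> 'rV[R]_m}).

(** The right-hand side of the equation [e = quad d e] in the unknown e, with
    parameter d: the general expression of degree at most 2 without constant
    term, without linear term in e and without square of d. *)
Definition quad (d : 'rV[R]_p) (e : 'rV[R]_m) := d *m S + b1 d e + b2 e e.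

(** Each bilinear increment is split so that one factor is an increment and the
    other a value at one end; no square of an increment is left over, which is
    what an exact Caratheodory factorization needs. *)
Lemma quadB d d' e e' : quad d' e' - quad d e =
  ((d' - d) *m S + b1 (d' - d) e) + (b1 d' (e' - e) + b2 e' (e' - e) + b2 (e' - e) e).
Proof.
rewrite /quad mulmxBl linearBl /= !linearBr /= linearBl /=.
apply/rowP => j; rewrite !mxE; ring.
Qed.

(** For small d the map [quad d] is a contraction of a fixed small ball, since its
    linear part in e is [b1 d] and its quadratic part is flat at 0. Continuity
    in d follows from the uniform contraction factor. *)
Lemma quad_solution : exists2 eps : R, 0 < eps &
  exists f : 'rV[R]_p -> 'rV[R]_m, [/\ f 0 = 0,
    forall d : 'rV[R]_p, `|d| < eps -> f d = quad d (f d) &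
    forall d : 'rV[R]_p, `|d| < eps -> {for d, continuous f}].
Proof.
have [k0 k00 k0P] := mulmx_bound R 1 p m.
have [k1 k10 k1P] := bilinear_schwarz (@mx_bilin_continuous _ _ _ _ _ _ b1).
have [k2 k20 k2P] := bilinear_schwarz (@mx_bilin_continuous _ _ _ _ _ _ b2).
(* With e and e' in the ball of radius r, the two halves of the quadratic part
   each contribute 1/8 to the Lipschitz constant; the bound on d makes the mixed
   part contribute 1/4. *)
pose r := (8 * k2)^-1; have r0 : 0 < r by rewrite invr_gt0 mulr_gt0.
pose c := k0 * (`|S| + 1); have c0 : 0 < c by rewrite mulr_gt0// ltr_wpDl.
have cP (d : 'rV[R]_p) : `|d *m S| <= c * `|d|.
apply: le_trans (k0P _ _) _; rewrite /c -!mulrA ler_wpM2l ?(ltW k00)//.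
  by rewrite mulrC ler_wpM2r ?lerDl.
pose eps := Num.min (4 * k1)^-1 (r / (2 * c)).
have eps0 : 0 < eps by rewrite lt_min ?invr_gt0 ?divr_gt0 ?mulr_gt0.
have epsP (d : 'rV[R]_p) : `|d| < eps -> k1 * `|d| <= 4^-1 /\ c * `|d| <= r / 2.
  rewrite lt_min => /andP[/ltW d1 /ltW d2]; split.
    by rewrite -ler_pdivlMl// (le_trans d1)// invfM mulrC.
  suff E : r / (2 * c) = c^-1 * (r / 2) by rewrite -ler_pdivlMl// -E.
  by field; rewrite gt_eqF.
pose U := [set e : 'rV[R]_m | `|e| <= r].
have psiB d e e' : `|d| < eps -> U e -> U e' ->
    `|quad d e' - quad d e| <= 2^-1 * `|e' - e|.
  move=> /epsP[d1 _] Ue Ue'.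
  rewrite quadB subrr mul0mx linear0l addr0 add0r.
  have -> : (2^-1 : R) = 4^-1 + 8^-1 + 8^-1 by field.
  rewrite !mulrDl; apply: le_trans (ler_normD _ _) _; apply: lerD; last first.
    apply: le_trans (k2P _ _) _; rewrite mulrAC ler_wpM2r//.
    by rewrite -ler_pdivlMl// -invfM mulrC.
  apply: le_trans (ler_normD _ _) _; apply: lerD.
    by apply: le_trans (k1P _ _) _; rewrite ler_wpM2r.
  apply: le_trans (k2P _ _) _; rewrite ler_wpM2r//.
  by rewrite -ler_pdivlMl// -invfM mulrC.
have psiU d : `|d| < eps -> forall e, U e -> U (quad d e).
  move=> de e Ue; have U0 : U 0 by rewrite /U /= normr0 ltW.
  have := psiB d 0 e de U0 Ue; have [_ d2] := epsP d de.
  rewrite subr0 {2}/quad !linear0r !addr0 => H.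
  rewrite /U /= -(subrK (d *m S) (quad d e)) (le_trans (ler_normD _ _))//.
  rewrite (splitr r) lerD//; last exact: le_trans (cP d) d2.
  by rewrite (le_trans H)// mulrC ler_wpM2r// invr_ge0.
have fixP d : exists e, `|d| < eps -> U e /\ e = quad d e.
  have [de|nde] := boolP (`|d| < eps); last by exists 0.
  pose F0 := isFun.Build _ _ U U (quad d) (psiU d de).
  pose F : {fun U >-> U} := HB.pack (quad d) F0.
  have ctr : is_contraction F.
    exists (2^-1)%:nng; split; first by rewrite /= invf_lt1// ltr1n.
    by move=> [x y] [Ux Uy] /=; exact: psiB.
  have clU : closed U.
    have -> : U = closed_ball_ Num.norm (0 : 'rV[R]_m) r.
      by apply/seteqP; split => e; rewrite /closed_ball_ /U /= sub0r normrN.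
    exact: closed_closed_ball_.
  have [|e Ue eE] := banach_fixed_point ctr clU.
    by exists 0; rewrite /U /= normr0 ltW.
  by exists e.
pose f d := sval (cid (fixP d)).
have fP d : `|d| < eps -> U (f d) /\ f d = quad d (f d) := svalP (cid (fixP d)).
exists eps => //; exists f; split=> [|d de|d de]; last 2 first.
- by have [] := fP d de.
- apply: (proj2 (@cvgrPdist_le R _ _ (nbhs d) _ f (f d))) => e e0.
  pose L := c + k1 * r; have L0 : 0 < L by rewrite addr_gt0 ?mulr_gt0.
  have dn : 0 < Num.min (eps - `|d|) (e / (2 * L)).
    by rewrite lt_min subr_gt0 de divr_gt0 ?mulr_gt0.
  have := nbhsx_ballx d _ dn; apply: filterS => d'.
  rewrite -ball_normE /ball_ /= lt_min => /andP[dd1 /ltW dd'].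
  have d'e : `|d'| < eps.
    by rewrite -(subrK d d') (le_lt_trans (ler_normD _ _))// -ltrBrDr distrC.
  have [Ufd fdE] := fP d de; have [Ufd' fdE'] := fP d' d'e.
  have H1 := psiB d' (f d') (f d) d'e Ufd' Ufd.
  have H2 : `|quad d (f d) - quad d' (f d)| <= L * `|d - d'|.
    rewrite quadB subrr !linear0r linear0l !addr0 mulrDl.
    apply: le_trans (ler_normD _ _) _; apply: lerD => //.
    by apply: le_trans (k1P _ _) _; rewrite mulrAC ler_wpM2r// ler_wpM2l// ltW.
  have : `|f d - f d'| <= 2^-1 * `|f d - f d'| + L * `|d - d'|.
    rewrite {1}fdE {1}fdE' -(subrK (quad d' (f d)) (quad d (f d))) -addrA addrC.
    exact: le_trans (ler_normD _ _) (lerD _ _).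
  have : L * `|d - d'| <= e / 2.
    rewrite -ler_pdivlMl// (le_trans dd')// le_eqVlt; apply/orP; left.
    by apply/eqP; field; rewrite gt_eqF.
  by move: `|f d - f d'| => x; lra.
have n0 : `|0 : 'rV[R]_p| < eps by rewrite normr0.
have [U0 f0E] := fP 0 n0.
have := psiB 0 0 (f 0) n0; rewrite -f0E /quad !linear0l !addr0 subr0.
have U00 : U 0 by rewrite /U /= normr0 ltW.
move=> /(_ U00 U0) H; apply/eqP; rewrite -normr_le0.
by move: `|f 0| H => x; lra.
Unshelve. all: by end_near. Qed.

End QuadraticEquation.

Section QuadraticSmooth.
Variables (R : realType) (E : normedModType R) (p m : nat).
Variables (S : 'M[R]_(p, m)) (b1 : {bilinear 'rV[R]_p -> 'rV[R]_m -> 'rV[R]_m})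
  (b2 : {bilinear 'rV[R]_m -> 'rV[R]_m -> 'rV[R]_m}).

(** [quad_dpar] and [quad_dunk] are the factors of the increments of d and of e in
    the difference of two equations [e = quad d e]. At e' = e they are the
    partial derivatives of [quad d e] in d and of [e - quad d e] in e. *)
Definition quad_dpar (e : 'rV[R]_m) : 'M[R]_(p, m) := S + lin1_mx (applyr b1 e).

Definition quad_dunk (d : 'rV[R]_p) (e' e : 'rV[R]_m) : 'M[R]_m :=
  1%:M - lin1_mx (b1 d) - lin1_mx (b2 e') - lin1_mx (applyr b2 e).

Lemma quad_fixB d d' e e' : e = quad S b1 b2 d e -> e' = quad S b1 b2 d' e' ->
  (e' - e) *m quad_dunk d' e' e = (d' - d) *m quad_dpar e.
Proof.
move=> eE e'E; have := quadB S b1 b2 d d' e e'; rewrite -eE -e'E => H.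
rewrite /quad_dunk /quad_dpar !mulmxBr mulmxDr mulmx1 !mul_rV_lin1 /=.
rewrite [X in X - _ - _ - _]H; apply/rowP => j; rewrite !mxE; ring.
Qed.

Section Ck.
Variables (k : nat) (O : set E) (oO : open O).

Lemma Ck_lin1_mxr q s t (b : {bilinear 'rV[R]_q -> 'rV[R]_s -> 'rV[R]_t})
    (f : E -> 'rV[R]_q) :
  Ck_on k O f -> Ck_on k O (fun x => lin1_mx (b (f x))).
Proof.
move=> Cf; apply: Ck_mx => // i j.
have -> : (fun x => lin1_mx (b (f x)) i j : R^o) =
  (fun x => (b (f x) (delta_mx 0 i)) 0 j : R^o) by apply/funext => x; rewrite mxE.
by apply: Ck_entry => //; apply: Ck_mxbilin => //; exact: Ck_cst.
Qed.

Lemma Ck_lin1_mxl q s t (b : {bilinear 'rV[R]_q -> 'rV[R]_s -> 'rV[R]_t})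
    (f : E -> 'rV[R]_s) :
  Ck_on k O f -> Ck_on k O (fun x => lin1_mx (applyr b (f x))).
Proof.
move=> Cf; apply: Ck_mx => // i j.
have -> : (fun x => lin1_mx (applyr b (f x)) i j : R^o) =
  (fun x => (b (delta_mx 0 i) (f x)) 0 j : R^o) by apply/funext => x; rewrite mxE.
by apply: Ck_entry => //; apply: Ck_mxbilin => //; exact: Ck_cst.
Qed.

Lemma Ck_quad_dpar (f : E -> 'rV[R]_m) :
  Ck_on k O f -> Ck_on k O (fun x => quad_dpar (f x)).
Proof. by move=> Cf; apply: CkD => //; [exact: Ck_cst|exact: Ck_lin1_mxl]. Qed.

Lemma Ck_quad_dunk d e' e : Ck_on k O d -> Ck_on k O e' -> Ck_on k O e ->
  Ck_on k O (fun x => quad_dunk (d x) (e' x) (e x)).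
Proof.
move=> Cd Ce' Ce; apply: (CkB oO); last exact: Ck_lin1_mxl.
apply: (CkB oO); last exact: Ck_lin1_mxr.
by apply: (CkB oO); [exact: Ck_cst|exact: Ck_lin1_mxr].
Qed.

End Ck.

Lemma open_unitmx q (O : set E) (f : E -> 'M[R]_q) : open O -> Ck_on 0 O f ->
  open (O `&` [set x | f x \in unitmx]).
Proof.
move=> oO Cf; have Cd := Ck_det oO Cf.
rewrite openE => x [Ox fx]; apply: filterI; first exact: open_nbhs_nbhs.
have : \det (f x) != 0 by move: fx; rewrite /= unitmxE unitfE.
have := Cd x Ox; rewrite /= => c /(@cvgr_neq0 R R^o _ _ _ _ _ c).
by apply: filterS => y /=; rewrite unitmxE unitfE.
Qed.

(** By [quad_fixB], the increment of e is the increment of d times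
    [quad_dpar *m invmx quad_dunk], so [caratheodory_diff] gives differentiability
    and a formula for the differential. That formula contains e itself but no
    derivative of e, hence is of class C^k when e is, and induction applies. *)
Theorem quad_smooth (O : set E) (d : E -> 'rV[R]_p) (e : E -> 'rV[R]_m) :
  open O -> smooth_on O d -> (forall x, O x -> {for x, continuous e}) ->
  (forall x, O x -> e x = quad S b1 b2 (d x) (e x)) ->
  (forall x, O x -> quad_dunk (d x) (e x) (e x) \in unitmx) ->
  smooth_on O e.
Proof.
move=> oO Cd ce eE eU.
pose N x := invmx (quad_dunk (d x) (e x) (e x)).
have de x : O x -> differentiable e x /\
    'd e x = (fun v => 'd d x v *m (quad_dpar (e x) *m N x)) :> (E -> _).
  move=> Ox; have [dd _] := Cd 1%N.
  pose f y := quad_dunk (d y) (e y) (e x).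
  have Cf : Ck_on 0 O f.
    by apply: Ck_quad_dunk => //; exact: Ck_cst.
  have oO' := open_unitmx oO Cf; set O' := _ `&` _ in oO'.
  have O'x : O' x by split => //; exact: eU.
  apply: (@caratheodory_diff _ _ _ _ _ _ (fun y => quad_dpar (e x) *m invmx (f y))).
  - have := open_nbhs_nbhs (conj oO' O'x); apply: filterS => y [Oy fU].
    rewrite mulmxA -(quad_fixB (eE x Ox) (eE y Oy)) -mulmxA.
    by rewrite mulmxV// mulmx1.
  - exact: dd.
  - have : Ck_on 0 O' (fun y => quad_dpar (e x) *m invmx (f y)).
      apply: Ck_mulmx => //; first exact: Ck_cst.
      by apply: Ck_invmx => // [y []//|]; apply: Ck_subset Cf => y [].
    by move=> /Ck_cont; apply.
move=> k; elim: k => [|k IH] //.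
split=> [x Ox|v]; first by have [] := de x Ox.
apply: (@Ck_ext _ _ _ _ _ (fun x => 'd d x v *m (quad_dpar (e x) *m N x))) => //.
  by move=> x Ox; have [_ ->] := de x Ox.
apply: Ck_mulmx => //; first by have [_ ] := Cd k.+1; exact.
apply: Ck_mulmx => //; first exact: Ck_quad_dpar.
by apply: Ck_invmx => //; apply: Ck_quad_dunk.
Qed.

End QuadraticSmooth.

(** * Products on R^r and morphism defects *)

(** Over a field an exact sequence splits. S and T form a contracting homotopy at
    the middle term; the normalization [S A S = S] makes [S A] a projector that
    kills the same row vectors as S. *)
Lemma splitting_of_exactness (F : fieldType) m p q
    (A : 'M[F]_(m, p)) (B : 'M[F]_(p, q)) :
  (forall y : 'rV_p, y *m B = 0 -> exists z : 'rV_m, y = z *m A) ->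
  exists S T, B *m T + S *m A = 1%:M /\ S *m A *m S = S.
Proof.
move=> exAB.
have [P AVA] : exists P, A *m P *m A = A by exists (pinvmx A); rewrite mulmxKpV.
have [Q BVB] : exists Q, B *m Q *m B = B by exists (pinvmx B); rewrite mulmxKpV.
have [S [ASA SAS]] : exists S, A *m S *m A = A /\ S *m A *m S = S.
  exists (P *m A *m P); rewrite !mulmxA !AVA; split=> //.
  have -> : P *m A *m P *m A *m P *m A *m P = P *m (A *m P *m A *m P *m A) *m P.
    by rewrite !mulmxA.
  by rewrite !AVA.
exists S, (Q *m (1%:M - S *m A)); split=> //.
have kB : (1%:M - B *m Q) *m B = 0 by rewrite mulmxBl mul1mx BVB subrr.
have : (1%:M - B *m Q) *m S *m A = 1%:M - B *m Q.
  apply/row_matrixP => i; rewrite !row_mul.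
  have [|z ->] := exAB (row i (1%:M - B *m Q)).
    by rewrite -row_mul kB row0.
  by rewrite -!mulmxA [A *m _]mulmxA ASA.
rewrite !mulmxBl mul1mx => /eqP; rewrite subr_eq => /eqP E.
rewrite mulmxBr mulmx1 mulmxBr !mulmxA [X in _ + X]E addrC -addrA.
by rewrite [_ + (_ - _)]addrCA subrr addr0 subrK.
Qed.

(** Exactness at the middle term is an open condition: a vector killed by S
    satisfies [y = y B T], and replacing B by a nearby B' leaves no room for a
    nonzero y. *)
Lemma splitting_perturb (F : fieldType) m p q
    (A : 'M[F]_(m, p)) (B B' : 'M[F]_(p, q)) S T (y : 'rV_p) :
  B *m T + S *m A = 1%:M -> 1%:M - (B - B') *m T \in unitmx ->
  y *m S = 0 -> y *m B' = 0 -> y = 0.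
Proof.
move=> BTSA U yS yB'; suff : y *m (1%:M - (B - B') *m T) = 0.
  by move/(congr1 (mulmxr (invmx (1%:M - (B - B') *m T)))); rewrite /= mulmxK// mul0mx.
rewrite mulmxBr -BTSA mulmxBl mulmxBr mulmxDr !mulmxA yB' yS !mul0mx addr0.
by rewrite subr0 subrr.
Qed.

Section Products.
Variables (R : realType) (r : nat).
Implicit Types (Mu Y : 'M[R]_(r * r, r)) (a b c : 'rV[R]_r) (h : 'M[R]_r).

(** Products on R^r are stored as matrices, acting on the tensor product of the
    arguments, so that they are points of a normed space. *)
Definition bil Mu a b : 'rV[R]_r := mxvec (a^T *m b) *m Mu.

Lemma bil_is_bilinear Mu : bilinear_for
  (GRing.Scale.Law.clone _ _ *:%R _) (GRing.Scale.Law.clone _ _ *:%R _) (bil Mu).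
Proof.
split=> [b|a] k u v; rewrite /bil.
  by rewrite linearP /= mulmxDl -scalemxAl linearP /= mulmxDl -scalemxAl.
by rewrite mulmxDr -scalemxAr linearP /= mulmxDl -scalemxAl.
Qed.
HB.instance Definition _ Mu := bilinear_isBilinear.Build R _ _ _ *:%R *:%R (bil Mu)
  (bil_is_bilinear Mu).

Lemma bilinear_sum_delta (f : {bilinear 'rV[R]_r -> 'rV[R]_r -> 'rV[R]_r}) a b :
  f a b = \sum_i \sum_j (a 0 i * b 0 j) *: f (delta_mx 0 i) (delta_mx 0 j).
Proof.
rewrite {1}(row_sum_delta a) linear_sumlz; apply: eq_bigr => i _.
rewrite linearZl_LR {1}(row_sum_delta b) linear_sumr /= scaler_sumr.
by apply: eq_bigr => j _; rewrite linearZr_LR /= scalerA.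
Qed.

Lemma bil_ext Mu Mu' : (forall a b, bil Mu a b = bil Mu' a b) -> Mu = Mu'.
Proof.
move=> E; apply/row_matrixP => k; case/mxvec_indexP: k => i j.
have := E (delta_mx 0 i) (delta_mx 0 j).
by rewrite /bil trmx_delta mul_delta_mx mxvec_delta -!rowE.
Qed.

Definition mx_of_bil (f : 'rV[R]_r -> 'rV[R]_r -> 'rV[R]_r) : 'M[R]_(r * r, r) :=
  \sum_i \sum_j (mxvec (delta_mx i j))^T *m f (delta_mx 0 i) (delta_mx 0 j).

Lemma mx_of_bilE (f : {bilinear 'rV[R]_r -> 'rV[R]_r -> 'rV[R]_r}) a b :
  bil (mx_of_bil f) a b = f a b.
Proof.
rewrite bilinear_sum_delta /bil /mx_of_bil mulmx_sumr; apply: eq_bigr => i _.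
rewrite mulmx_sumr; apply: eq_bigr => j _; rewrite mulmxA.
have -> : mxvec (a^T *m b) *m (mxvec (delta_mx i j))^T = (a 0 i * b 0 j)%:M.
  rewrite mxvec_delta trmx_delta; apply/rowP => k; rewrite !ord1.
  by rewrite -colE !mxE mxvecE !mxE big_ord1 !mxE eqxx mulr1n ![ord0]ord1.
by rewrite mul_scalar_mx.
Qed.

Definition pull Mu h h' := mx_of_bil (fun a b => bil Mu (a *m h) (b *m h')).

Lemma pullE Mu h h' a b : bil (pull Mu h h') a b = bil Mu (a *m h) (b *m h').
Proof.
pose f a b := bil Mu (a *m h) (b *m h').
have fb : bilinear_for
    (GRing.Scale.Law.clone _ _ *:%R _) (GRing.Scale.Law.clone _ _ *:%R _) f.
  split=> [v|v] k u w; rewrite /f mulmxDl -scalemxAl.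
    by rewrite linearDl linearZl_LR.
  by rewrite linearDr linearZr_LR.
pose fM := bilinear_isBilinear.Build R _ _ _ _ _ f fb.
pose fB : {bilinear _ -> _ -> _} := HB.pack f fM.
exact: (mx_of_bilE fB).
Qed.

Lemma bil_mulmx Mu h a b : bil (Mu *m h) a b = bil Mu a b *m h.
Proof. by rewrite /bil mulmxA. Qed.
Lemma bilD Mu Mu' a b : bil (Mu + Mu') a b = bil Mu a b + bil Mu' a b.
Proof. by rewrite /bil mulmxDr. Qed.
Lemma bilN Mu a b : bil (- Mu) a b = - bil Mu a b.
Proof. by rewrite /bil mulmxN. Qed.
Lemma bilZ k Mu a b : bil (k *: Mu) a b = k *: bil Mu a b.
Proof. by rewrite /bil scalemxAr. Qed.
Lemma bil0 a b : bil 0 a b = 0.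
Proof. by rewrite /bil mulmx0. Qed.

End Products.

Section Rigidity.
Variables (R : realType) (r : nat).
Implicit Types (Mu Y : 'M[R]_(r * r, r)) (a b c : 'rV[R]_r) (h : 'M[R]_r).

Definition assoc_defect Mu a b c := bil Mu a (bil Mu b c) - bil Mu (bil Mu a b) c.

Definition kv_mx Mu := forall a b c, assoc_defect Mu a b c = assoc_defect Mu b a c.

Variable Mu0 : 'M[R]_(r * r, r).

(** For [Mu = Mu0] and h = 1 the difference [twisted_cocycle] is minus the
    coboundary of the 2-cochain Y. In general it is the expression obtained when
    the arguments are multiplied by Mu before Y is applied, while the values of
    Y are multiplied by Mu0, with h carrying the arguments over. *)
Definition half_cocycle Mu h Y a b c :=
  bil Mu0 (a *m h) (bil Y b c) + bil Y a (bil Mu b c)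
  - bil Mu0 (bil Y a b) (c *m h) - bil Y (bil Mu a b) c.

Definition twisted_cocycle Mu h Y a b c :=
  half_cocycle Mu h Y a b c - half_cocycle Mu h Y b a c.

Definition morphism_defect Mu h := Mu *m h - pull Mu0 h h.

Lemma morphism_defectE Mu h a b :
  bil (morphism_defect Mu h) a b = bil Mu a b *m h - bil Mu0 (a *m h) (b *m h).
Proof. by rewrite bilD bilN bil_mulmx pullE. Qed.

(** Pushing the identity of Mu through h replaces each product by a Mu0-product
    plus a defect. The terms without defect cancel by the identity of Mu0, and
    those that remain are linear in the defect: no quadratic remainder has to be
    estimated. *)
Lemma morphism_defect_cocycle Mu h a b c : kv_mx Mu0 -> kv_mx Mu ->
  twisted_cocycle Mu h (morphism_defect Mu h) a b c = 0.
Proof.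
move=> kv0 kv.
have halfE x y z : half_cocycle Mu h (morphism_defect Mu h) x y z =
    assoc_defect Mu x y z *m h - assoc_defect Mu0 (x *m h) (y *m h) (z *m h).
  rewrite /half_cocycle !morphism_defectE /assoc_defect mulmxBl.
  rewrite linearBr linearBl /=; apply/rowP => j; rewrite !mxE; ring.
by rewrite /twisted_cocycle !halfE (kv0 (a *m h)) (kv a) subrr.
Qed.

(** The coordinates of the trilinear map [twisted_cocycle] on the standard basis,
    so that it can be treated as a linear map between row vectors. *)
Definition cocycle_row Mu h (y : 'rV[R]_(r * r * r)) :
    'rV[R]_#|{: 'I_r * 'I_r * 'I_r * 'I_r}| := \row_t
  let: (i, j, k, l) := enum_val t in
  twisted_cocycle Mu h (vec_mx y) (delta_mx 0 i) (delta_mx 0 j) (delta_mx 0 k) 0 l.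

Definition cocycle_mx Mu h := lin1_mx (cocycle_row Mu h).

Section LinearCombinators.
Variable W : lmodType R.

Lemma lin_add (V : lmodType R) (f g : W -> V) :
  linear f -> linear g -> linear (fun x => f x + g x).
Proof. by move=> fl gl k x y; rewrite fl gl scalerDr addrACA. Qed.

Lemma lin_sub (V : lmodType R) (f g : W -> V) :
  linear f -> linear g -> linear (fun x => f x - g x).
Proof.
by move=> fl gl; apply: lin_add => // k x y; rewrite gl opprD scalerN.
Qed.

Lemma lin_bil_l Mu (f : W -> 'rV[R]_r) b : linear f -> linear (fun x => bil Mu (f x) b).
Proof. by move=> fl k x y; rewrite fl linearPl. Qed.

Lemma lin_bil_r Mu (f : W -> 'rV[R]_r) a : linear f -> linear (fun x => bil Mu a (f x)).
Proof. by move=> fl k x y; rewrite fl linearDr linearZr_LR. Qed.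

Lemma lin_bil_mx (f : W -> 'M[R]_(r * r, r)) a b :
  linear f -> linear (fun x => bil (f x) a b).
Proof. by move=> fl k x y; rewrite fl bilD bilZ. Qed.

Lemma lin_mulmx h (f : W -> 'rV[R]_r) : linear f -> linear (fun x => f x *m h).
Proof. by move=> fl k x y; rewrite fl mulmxDl scalemxAl. Qed.

Lemma lin_id : linear (fun x : W => x).
Proof. by []. Qed.

End LinearCombinators.

Lemma twisted_cocycle_linear Mu h a b c :
  linear (fun Y => twisted_cocycle Mu h Y a b c).
Proof.
have half_lin x y z : linear (fun Y => half_cocycle Mu h Y x y z).
  rewrite /half_cocycle; apply: lin_sub; last exact: (lin_bil_mx _ _ (@lin_id _)).
  apply: lin_sub; last by apply: lin_bil_l; exact: (lin_bil_mx _ _ (@lin_id _)).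
  apply: lin_add; last exact: (lin_bil_mx _ _ (@lin_id _)).
  by apply: lin_bil_r; exact: (lin_bil_mx _ _ (@lin_id _)).
by apply: lin_sub.
Qed.

Lemma mul_cocycle_mx Mu h y : y *m cocycle_mx Mu h = cocycle_row Mu h y.
Proof.
have fl : linear (cocycle_row Mu h).
  move=> k u v; apply/rowP => t; rewrite !mxE.
  case: (enum_val t) => [[[i j] k'] l].
  by rewrite linearP twisted_cocycle_linear !mxE.
pose fM := GRing.isLinear.Build _ _ _ _ (cocycle_row Mu h) fl.
pose fL : {linear _ -> _} := HB.pack (cocycle_row Mu h) fM.
exact: (mul_rV_lin1 fL).
Qed.

Lemma trilinear_eq0 (f : 'rV[R]_r -> 'rV[R]_r -> 'rV[R]_r -> 'rV[R]_r) :
  (forall b c, linear (fun a => f a b c)) -> (forall a c, linear (fun b => f a b c)) ->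
  (forall a b, linear (f a b)) ->
  (forall i j k, f (delta_mx 0 i) (delta_mx 0 j) (delta_mx 0 k) = 0) ->
  forall a b c, f a b c = 0.
Proof.
have lin0 (g : 'rV[R]_r -> 'rV[R]_r) : linear g ->
    (forall i, g (delta_mx 0 i) = 0) -> forall a, g a = 0.
  move=> gl g0 a.
  pose gM := GRing.isLinear.Build _ _ _ _ g gl.
  pose gL : {linear _ -> _} := HB.pack g gM.
  rewrite (row_sum_delta a) -[g _]/(gL _) linear_sum big1// => i _.
  by rewrite linearZ /= g0 scaler0.
move=> la lb lc f0 a b c.
apply: (lin0 (f a b)) => // k; apply: (lin0 (fun b => f a b _)) => // j.
exact: (lin0 (fun a => f a _ _)).
Qed.

Section HalfCocycleLinear.
Variables (Mu : 'M[R]_(r * r, r)) (h : 'M[R]_r) (Y : 'M[R]_(r * r, r)).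

Lemma half_cocycle_lin1 b c : linear (fun a => half_cocycle Mu h Y a b c).
Proof.
rewrite /half_cocycle; apply: lin_sub; first apply: lin_sub; first apply: lin_add.
- exact: (lin_bil_l _ _ (lin_mulmx h (@lin_id _))).
- exact: (lin_bil_l _ _ (@lin_id _)).
- exact: (lin_bil_l _ _ (lin_bil_l _ _ (@lin_id _))).
- exact: (lin_bil_l _ _ (lin_bil_l _ _ (@lin_id _))).
Qed.

Lemma half_cocycle_lin2 a c : linear (fun b => half_cocycle Mu h Y a b c).
Proof.
rewrite /half_cocycle; apply: lin_sub; first apply: lin_sub; first apply: lin_add.
- exact: (lin_bil_r _ _ (lin_bil_l _ _ (@lin_id _))).
- exact: (lin_bil_r _ _ (lin_bil_l _ _ (@lin_id _))).
- exact: (lin_bil_l _ _ (lin_bil_r _ _ (@lin_id _))).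
- exact: (lin_bil_l _ _ (lin_bil_r _ _ (@lin_id _))).
Qed.

Lemma half_cocycle_lin3 a b : linear (half_cocycle Mu h Y a b).
Proof.
rewrite /half_cocycle; apply: lin_sub; first apply: lin_sub; first apply: lin_add.
- exact: (lin_bil_r _ _ (lin_bil_r _ _ (@lin_id _))).
- exact: (lin_bil_r _ _ (lin_bil_r _ _ (@lin_id _))).
- exact: (lin_bil_r _ _ (lin_mulmx h (@lin_id _))).
- exact: (lin_bil_r _ _ (@lin_id _)).
Qed.

End HalfCocycleLinear.

Lemma mul_cocycle_mx_eq0 Mu h (y : 'rV_(r * r * r)) :
  y *m cocycle_mx Mu h = 0 <->
  forall a b c, twisted_cocycle Mu h (vec_mx y) a b c = 0.
Proof.
rewrite mul_cocycle_mx; split=> [y0|y0]; last first.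
  apply/rowP => t; rewrite !mxE; case: (enum_val t) => [[[i j] k] l].
  by rewrite y0 mxE.
apply: trilinear_eq0 => [b c|a c|a b|i j k]; last first.
  apply/rowP => l; rewrite [RHS]mxE.
  have <- : cocycle_row Mu h y 0 (enum_rank (i, j, k, l)) =
      twisted_cocycle Mu h (vec_mx y) (delta_mx 0 i) (delta_mx 0 j) (delta_mx 0 k) 0 l.
    by rewrite mxE enum_rankK.
  by rewrite y0 mxE.
all: rewrite /twisted_cocycle; apply: lin_sub.
- exact: half_cocycle_lin3.
- exact: half_cocycle_lin3.
- exact: half_cocycle_lin2.
- exact: half_cocycle_lin1.
- exact: half_cocycle_lin1.
- exact: half_cocycle_lin2.
Qed.

(** The derivative of the defect in h at [(Mu0, 1)], which is also the coboundary
    of H as a 1-cochain. *)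
Definition defect_d1 (H : 'M[R]_r) := Mu0 *m H - pull Mu0 H 1%:M - pull Mu0 1%:M H.

Lemma pullDl Mu h1 h2 h' : pull Mu (h1 + h2) h' = pull Mu h1 h' + pull Mu h2 h'.
Proof. by apply: bil_ext => a b; rewrite bilD !pullE mulmxDr linearDl. Qed.
Lemma pullDr Mu h h1 h2 : pull Mu h (h1 + h2) = pull Mu h h1 + pull Mu h h2.
Proof. by apply: bil_ext => a b; rewrite bilD !pullE mulmxDr linearDr. Qed.
Lemma pullZl Mu k h h' : pull Mu (k *: h) h' = k *: pull Mu h h'.
Proof. by apply: bil_ext => a b; rewrite bilZ !pullE -scalemxAr linearZl_LR. Qed.
Lemma pullZr Mu k h h' : pull Mu h (k *: h') = k *: pull Mu h h'.
Proof. by apply: bil_ext => a b; rewrite bilZ !pullE -scalemxAr linearZr_LR. Qed.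
Lemma pull1 Mu : pull Mu 1%:M 1%:M = Mu.
Proof. by apply: bil_ext => a b; rewrite pullE !mulmx1. Qed.

Lemma defect_d1_linear : linear defect_d1.
Proof.
move=> k H H'; rewrite /defect_d1 mulmxDr -scalemxAr.
rewrite pullDl pullDr pullZl pullZr; apply/matrixP => i j; rewrite !mxE; ring.
Qed.
HB.instance Definition _ := GRing.isLinear.Build R _ _ _ defect_d1 defect_d1_linear.

Lemma morphism_defect_expand D H : morphism_defect (Mu0 + D) (1%:M + H) =
  D + defect_d1 H + D *m H - pull Mu0 H H.
Proof.
rewrite /morphism_defect /defect_d1 mulmxDr mulmx1 mulmxDl.
rewrite pullDl !pullDr pull1; apply/matrixP => i j; rewrite !mxE; ring.
Qed.

End Rigidity.

(** * Rigidity of Koszul-Vinberg products with vanishing H^2 *)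

Section RigidFamily.
Variables (R : realType) (r : nat) (Mu0 : 'M[R]_(r * r, r)).
Variable S : 'M[R]_(r * r * r, r * r).
Local Notation pdim := (r * r * r)%N.
Local Notation udim := (r * r)%N.

Definition eq_mixed (d : 'rV[R]_pdim) (e : 'rV[R]_udim) : 'rV[R]_udim :=
  mxvec (vec_mx d *m vec_mx e) *m (- S).

Definition eq_square (e e' : 'rV[R]_udim) : 'rV[R]_udim :=
  mxvec (pull Mu0 (vec_mx e) (vec_mx e')) *m S.

Lemma eq_mixed_bilinear : bilinear_for
  (GRing.Scale.Law.clone _ _ *:%R _) (GRing.Scale.Law.clone _ _ *:%R _) eq_mixed.
Proof.
split=> [e|d] k u v; rewrite /eq_mixed linearP.
  by rewrite mulmxDl -scalemxAl linearP mulmxDl -scalemxAl.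
by rewrite mulmxDr -scalemxAr linearP mulmxDl -scalemxAl.
Qed.
HB.instance Definition _ := bilinear_isBilinear.Build R _ _ _ *:%R *:%R eq_mixed
  eq_mixed_bilinear.

Lemma eq_square_bilinear : bilinear_for
  (GRing.Scale.Law.clone _ _ *:%R _) (GRing.Scale.Law.clone _ _ *:%R _) eq_square.
Proof.
split=> [e|d] k u v; rewrite /eq_square linearP.
  by rewrite pullDl pullZl linearP mulmxDl -scalemxAl.
by rewrite pullDr pullZr linearP mulmxDl -scalemxAl.
Qed.
HB.instance Definition _ := bilinear_isBilinear.Build R _ _ _ *:%R *:%R eq_square
  eq_square_bilinear.

(** The equation [e = quad d e] reads [e + (F - e A) S = 0] for the defect F.
    Multiplying it by [A S] and using [S A S = S] leaves [F S = 0]. The summand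
    [e - e A S] is what makes the linear part in e the identity even though A
    need not be injective. *)
Lemma projected_defect_eq0 (d : 'rV[R]_pdim) (e : 'rV[R]_udim) :
  S *m lin_mx (defect_d1 Mu0) *m S = S ->
  e = quad (- S) eq_mixed eq_square d e ->
  mxvec (morphism_defect Mu0 (Mu0 + vec_mx d) (1%:M + vec_mx e)) *m S = 0.
Proof.
set A := lin_mx _ => SAS eE.
pose F := mxvec (morphism_defect Mu0 (Mu0 + vec_mx d) (1%:M + vec_mx e)).
have FE : F *m S = e *m A *m S - quad (- S) eq_mixed eq_square d e.
  have DE : mxvec (defect_d1 Mu0 (vec_mx e)) = e *m A.
    by rewrite -[e in RHS]vec_mxK mul_vec_lin.
  rewrite /F morphism_defect_expand; move: (defect_d1 Mu0 _) DE => G DE.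
  have -> : mxvec (vec_mx d + G + vec_mx d *m vec_mx e
                   - pull Mu0 (vec_mx e) (vec_mx e)) =
      d + e *m A + mxvec (vec_mx d *m vec_mx e)
      - mxvec (pull Mu0 (vec_mx e) (vec_mx e)).
    by rewrite linearB !linearD /= vec_mxK DE.
  have -> : quad (- S) eq_mixed eq_square d e = - (d *m S)
      - mxvec (vec_mx d *m vec_mx e) *m S + mxvec (pull Mu0 (vec_mx e) (vec_mx e)) *m S.
    by rewrite -!mulmxN.
  rewrite mulmxBl !mulmxDl.
  set x := d *m S; set y := e *m A *m S.
  set z := mxvec (_ *m _) *m S; set t := mxvec _ *m S.
  by move: x y z t => x y z t; apply/rowP => j; rewrite !mxE; ring.
have : F *m S *m A *m S = F *m S by rewrite -!mulmxA [S *m _]mulmxA SAS.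
rewrite -/F {1}FE -eE !mulmxBl -!mulmxA [S *m _]mulmxA SAS FE -eE !mulmxA.
by move=> H; rewrite -H subrr.
Qed.

Lemma Ck_bil (E : normedModType R) k (O : set E) Mu a b : open O ->
  Ck_on k O Mu -> Ck_on k O a -> Ck_on k O b ->
  Ck_on k O (fun x => bil (Mu x : 'M[R]_(r * r, r)) (a x) (b x)).
Proof.
move=> oO CM Ca Cb; apply: Ck_mulmx => //.
apply: (@Ck_mxlin _ _ _ oO _ _ _ _ (mxvec : {linear 'M[R]_(r, r) -> 'rV[R]_(r * r)})).
apply: Ck_mulmx => //.
exact: (@Ck_mxlin _ _ _ oO _ _ _ _ (trmx : {linear 'rV[R]_r -> 'cV[R]_r})).
Qed.

End RigidFamily.

Section RigidityTheorem.
Variables (R : realType) (r : nat) (Mu0 : 'M[R]_(r * r, r)).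
Local Notation pdim := (r * r * r)%N.
Local Notation udim := (r * r)%N.

Lemma Ck_half_cocycle (E : normedModType R) k (O : set E) Mu h Y a b c : open O ->
  Ck_on k O Mu -> Ck_on k O h ->
  Ck_on k O (fun x => half_cocycle Mu0 (Mu x) (h x) Y a b c).
Proof.
move=> oO CM Ch.
have C0 n1 n2 (A : 'M[R]_(n1, n2)) : Ck_on k O (fun=> A) by exact: Ck_cst.
have Cm (x : 'rV[R]_r) : Ck_on k O (fun y => x *m h y) by exact: Ck_mulmx.
apply: CkB => //; last by apply: Ck_bil => //; exact: Ck_bil.
apply: CkB => //; last by apply: Ck_bil => //; exact: Ck_bil.
by apply: CkD => //; apply: Ck_bil => //; exact: Ck_bil.
Qed.

Lemma Ck_cocycle_mx (E : normedModType R) k (O : set E) Mu h : open O ->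
  Ck_on k O Mu -> Ck_on k O h -> Ck_on k O (fun x => cocycle_mx Mu0 (Mu x) (h x)).
Proof.
move=> oO CM Ch; apply: Ck_mx => // i t.
case tE : (enum_val t) => [[[i1 j1] k1] l1].
have -> : (fun x => cocycle_mx Mu0 (Mu x) (h x) i t : R^o) = (fun x =>
   twisted_cocycle Mu0 (Mu x) (h x) (vec_mx (delta_mx 0 i)) (delta_mx 0 i1)
     (delta_mx 0 j1) (delta_mx 0 k1) 0 l1 : R^o).
  by apply/funext => x; rewrite [LHS]mxE [LHS]mxE tE.
by apply: Ck_entry => //; apply: CkB => //; exact: Ck_half_cocycle.
Qed.

(** The last conclusion is stated for parameters d running along a smooth map
    because that is the form in which a chart of M uses it. *)
Theorem rigid_product : kv_mx Mu0 ->
  (forall Y, (forall a b c, twisted_cocycle Mu0 Mu0 1%:M Y a b c = 0) ->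
     exists H, Y = defect_d1 Mu0 H) ->
  exists2 eps : R, 0 < eps & exists hf : 'rV[R]_pdim -> 'M[R]_r, [/\
    forall d : 'rV_pdim, `|d| < eps -> hf d \in unitmx,
    forall d : 'rV_pdim, `|d| < eps -> kv_mx (Mu0 + vec_mx d) ->
      morphism_defect Mu0 (Mu0 + vec_mx d) (hf d) = 0 &
    forall (E : normedModType R) (O : set E) (d : E -> 'rV[R]_pdim),
      open O -> smooth_on O d -> (forall x, O x -> `|d x| < eps) ->
      smooth_on O (hf \o d)].
Proof.
move=> kv0 rig.
pose A := lin_mx (defect_d1 Mu0); pose B := cocycle_mx Mu0 Mu0 1%:M.
have [S [T [BTSA SAS]]] : exists S T, B *m T + S *m A = 1%:M /\ S *m A *m S = S.
  apply: splitting_of_exactness => y /mul_cocycle_mx_eq0 /rig[H YE].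
  by exists (mxvec H); rewrite /A mul_vec_lin /= -YE vec_mxK.
have [eps1 eps10 [f [f0 fE fc]]] := quad_solution (- S) (eq_mixed S) (eq_square Mu0 S).
pose O1 := ball (0 : 'rV[R]_pdim) eps1.
have O1E d : O1 d = (`|d| < eps1) :> Prop by rewrite /O1 -ball_normE /= sub0r normrN.
have oO1 : open O1 by exact: ball_open.
have O10 : O1 0 by rewrite O1E normr0.
have Cf : Ck_on 0 O1 f by move=> d; rewrite O1E => /fc.
pose h d : 'M[R]_r := 1%:M + vec_mx (f d).
have Cvec (E : normedModType R) m n k (O : set E) (g : E -> 'rV[R]_(m * n)) :
    open O -> Ck_on k O g -> Ck_on k O (fun x => vec_mx (g x)).
  move=> oO Cg; exact: (@Ck_mxlin _ _ _ oO _ _ _ _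
    (vec_mx : {linear 'rV[R]_(m * n) -> 'M[R]_(m, n)})).
have Ch (E : normedModType R) k (O : set E) (g : E -> 'rV[R]_udim) : open O ->
    Ck_on k O g -> Ck_on k O (fun x => 1%:M + vec_mx (g x) : 'M[R]_r).
  by move=> oO Cg; apply: CkD => //; [exact: Ck_cst|exact: Cvec].
have CM k (O : set 'rV[R]_pdim) : open O ->
    Ck_on k O (fun d : 'rV[R]_pdim => Mu0 + vec_mx d : 'M[R]_(udim, r)).
  by move=> oO; apply: CkD => //; [exact: Ck_cst|apply: Cvec => //; exact: Ck_id].
(* Three matrices depending continuously on d must remain invertible: h itself,
   the one in [splitting_perturb], and the derivative in [quad_smooth]. *)
pose U1 d := h d.
pose U2 d := 1%:M - (B - cocycle_mx Mu0 (Mu0 + vec_mx d) (h d)) *m T.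
pose U3 d := quad_dunk (eq_mixed S) (eq_square Mu0 S) d (f d) (f d).
have C1 : Ck_on 0 O1 U1 by apply: Ch.
have C2 : Ck_on 0 O1 U2.
  have CC : Ck_on 0 O1 (fun d => cocycle_mx Mu0 (Mu0 + vec_mx d) (h d)).
    exact: (@Ck_cocycle_mx _ 0 O1 (fun d => Mu0 + vec_mx d) h oO1 (CM _ _ oO1) C1).
  have CBC := CkB oO1 (Ck_cst 0 O1 B) CC.
  exact: (CkB oO1 (Ck_cst 0 O1 1%:M) (Ck_mulmx oO1 CBC (Ck_cst 0 O1 T))).
have C3 : Ck_on 0 O1 U3 by apply: Ck_quad_dunk => //; exact: Ck_id.
have h0 : h 0 = 1%:M by rewrite /h f0 linear0 addr0.
have U10 : U1 0 \in unitmx by rewrite /U1 h0 unitmx1.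
have U20 : U2 0 \in unitmx.
  by rewrite /U2 h0 linear0 addr0 subrr mul0mx subr0 unitmx1.
have U30 : U3 0 \in unitmx.
  rewrite /U3 /quad_dunk f0.
  have lin1_0 n (g : {linear 'rV[R]_n -> 'rV[R]_udim}) :
      (forall x, g x = 0) -> lin1_mx g = 0.
    by move=> g0; apply/row_matrixP => i; rewrite rowE mul_rV_lin1 g0 row0.
  rewrite !lin1_0 ?subr0 ?unitmx1// => x /=; first exact: linear0r.
    exact: linear0l.
  exact: linear0l.
have : nbhs (0 : 'rV[R]_pdim) (O1 `&` [set d | U1 d \in unitmx] `&`
    [set d | U2 d \in unitmx] `&` [set d | U3 d \in unitmx]).
  apply: filterI; [apply: filterI|].
  - exact: (open_nbhs_nbhs (conj (open_unitmx oO1 C1) (conj O10 U10))).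
  - have := open_nbhs_nbhs (conj (open_unitmx oO1 C2) (conj O10 U20)).
    by apply: filterS => x [].
  - have := open_nbhs_nbhs (conj (open_unitmx oO1 C3) (conj O10 U30)).
    by apply: filterS => x [].
move=> /nbhs_ballP[eps /= eps0 sub].
have epsP (d : 'rV[R]_pdim) : `|d| < eps ->
    [/\ O1 d, U1 d \in unitmx, U2 d \in unitmx & U3 d \in unitmx].
  move=> de; have [|[[]]] := sub d; last by split.
  by rewrite -ball_normE /= sub0r normrN.
exists eps => //; exists h; split.
- by move=> d /epsP[].
- move=> d /epsP[ O1d _ U2d _] kv.
  have eE : f d = quad (- S) (eq_mixed S) (eq_square Mu0 S) d (f d).
    by apply: fE; rewrite -O1E.
  have FS := projected_defect_eq0 SAS eE.
  apply: (can_inj mxvecK); rewrite linear0.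
  apply: (splitting_perturb BTSA U2d FS).
  by apply/mul_cocycle_mx_eq0 => a b c; rewrite mxvecK; exact: morphism_defect_cocycle.
- move=> E O d oO Cd dO.
  have cf x : O x -> {for x, continuous (f \o d)}.
    move=> Ox; apply: continuous_comp; first exact: (Ck_cont (Cd 0%N) Ox).
    by have [] := epsP _ (dO x Ox); rewrite O1E => /fc.
  have fdE x : O x ->
      (f \o d) x = quad (- S) (eq_mixed S) (eq_square Mu0 S) (d x) ((f \o d) x).
    by move=> Ox; apply: fE; have [] := epsP _ (dO x Ox); rewrite O1E.
  have fdU x : O x -> quad_dunk (eq_mixed S) (eq_square Mu0 S)
      (d x) ((f \o d) x) ((f \o d) x) \in unitmx.
    by move=> Ox; have [] := epsP _ (dO x Ox).
  have Cfd := quad_smooth oO Cd cf fdE fdU.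
  by move=> k; exact: (Ch _ _ _ (f \o d)).
Qed.

End RigidityTheorem.

Section H2Unfold.
Variables (R : realType) (A : lmodType R) (mu : kv_algebra A).

Let i1 : 'I_3 := lift ord0 (ord0 : 'I_2).

Lemma coboundary2E (f : A -> A -> A) (a : 'I_3 -> A) :
  let x := a ord0 in let y := a i1 in let z := a ord_max in
  coboundary mu (fun b : 'I_2 -> A => f (b ord0) (b ord_max)) a =
    (mu y (f x z) - f (mu y x) z - f x (mu y z) + mu (f x y) z)
    - (mu x (f y z) - f (mu x y) z - f y (mu x z) + mu (f y x) z).
Proof.
move=> x y z; rewrite /coboundary !big_ord_recl big_ord0 addr0 /=.
rewrite /kv_act !big_ord_recl !big_ord0 !addr0 /=.
have eM : lift ord0 ord0 = ord_max :> 'I_2 by apply: val_inj.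
rewrite !eM.
have e0 : widen_ord (leqnSn 2) ord0 = ord0 :> 'I_3 by apply: val_inj.
have e1 : widen_ord (leqnSn 2) ord_max = i1 by apply: val_inj.
have e00 : lift (ord0 : 'I_3) (ord0 : 'I_2) = i1 by apply: val_inj.
have e01 : lift (ord0 : 'I_3) (ord_max : 'I_2) = ord_max by apply: val_inj.
have e10 : lift i1 (ord0 : 'I_2) = ord0 by apply: val_inj.
have e11 : lift i1 (ord_max : 'I_2) = ord_max by apply: val_inj.
rewrite !(e0, e1) !(e00, e01, e10, e11) -/x -/y -/z.
rewrite expr1 scaleN1r (_ : (bump 0 0).+1 = 2%N)// sqrrN expr1n scale1r addrC.
by rewrite !opprD !addrA.
Qed.

Lemma coboundary1E (phi : A -> A) (a : 'I_2 -> A) :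
  coboundary mu (fun b : 'I_1 -> A => phi (b ord0)) a =
    phi (mu (a ord0) (a ord_max)) - mu (a ord0) (phi (a ord_max))
    - mu (phi (a ord0)) (a ord_max).
Proof.
rewrite /coboundary big_ord1 /kv_act big_ord1 /=.
have e0 : widen_ord (leqnSn 1) ord0 = ord0 :> 'I_2 by apply: val_inj.
have e1 : lift (widen_ord (leqnSn 1) ord0) ord0 = ord_max :> 'I_2 by apply: val_inj.
by rewrite e1 e0 expr1 scaleN1r opprD opprB.
Qed.

(** A cocycle belongs to its own class, so if that class is the zero class the
    cocycle is a coboundary. *)
Lemma H2_eq0_cobounds (f : A -> A -> A) : H2_eq0 mu ->
  (forall b, linear (f^~ b)) -> (forall a, linear (f a)) ->
  (forall x y z, mu x (f y z) - f (mu x y) z - f y (mu x z) + mu (f y x) z =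
                 mu y (f x z) - f (mu y x) z - f x (mu y z) + mu (f x y) z) ->
  exists2 phi : A -> A, linear phi &
    forall x y, f x y = phi (mu x y) - mu x (phi y) - mu (phi x) y.
Proof.
move=> H20 fl fr fc; pose Th : cochain A 2 := fun b => f (b ord0) (b ord_max).
have Thc : cocycle mu Th.
  split=> [a i k u v|a]; last by rewrite coboundary2E fc subrr.
  rewrite /Th /=.
  have [->|i0] := eqVneq i ord0; first by rewrite /= fl.
  have -> : i = ord_max by apply: val_inj; case: i i0 => [[|[|]]].
  by rewrite /= fr.
have : H2 mu (cohomology_class mu Th) by exists Th.
rewrite H20 /= => clE.
have : cohomology_class mu Th Th.
  exists (fun=> 0) => [a i k u v|a]; first by rewrite scaler0 addr0.
  have := coboundary1E (fun=> 0) a; rewrite linear0r linear0l !subr0 => ->.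
  by rewrite addr0.
rewrite clE => -[Phi Phil PhiE].
exists (fun v => Phi (fun=> v)).
  move=> k u v; have := Phil (fun=> 0) ord0 k u v.
  have e w : [eta (fun=> 0) with ord0 |-> w] = (fun=> w) :> ('I_1 -> A).
    by apply/funext => i; rewrite /= ord1 eqxx.
  by rewrite !e.
move=> x y; have := PhiE (fun i : 'I_2 => if i == ord0 then x else y).
rewrite add0r /Th /= => ->.
have E : (fun b : 'I_1 -> A => Phi (fun=> b ord0)) = Phi.
  by apply/funext => b; congr Phi; apply/funext => i; congr (b _); rewrite !ord1.
have := coboundary1E (fun v => Phi (fun=> v))
  (fun i : 'I_2 => if i == ord0 then x else y).
by rewrite E /=.
Qed.

End H2Unfold.

(** * Bump functions *)

Section FlatFunction.
Variable R : realType.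
Implicit Types (n : nat) (t : R).

(** The functions t^-n exp(-1/t), extended by 0. The whole family is considered
    because it is closed under differentiation up to linear combinations. *)
Definition flat n t : R := if 0 < t then t^-1 ^+ n * expR (- t^-1) else 0.

Definition flat' n t : R := flat n.+2 t - n%:R * flat n.+1 t.

Lemma flat_gt0 n t : (flat n t != 0) = (0 < t).
Proof.
rewrite /flat; case: ltP => t0; last by rewrite eqxx.
by apply: mulf_neq0; rewrite ?expf_neq0 ?invr_eq0 ?gt_eqF ?expR_gt0.
Qed.

Lemma flat_le0 n t : t <= 0 -> flat n t = 0.
Proof. by rewrite /flat; case: ltP. Qed.

(** From [expR x >= x^(n+2) / (n+2)!] at x = 1/t. A quadratic bound is what gives
    derivative 0 at the origin. *)
Lemma flat_bound n t : `|flat n t| <= n.+2`!%:R * t ^+ 2.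
Proof.
have [t0|t0] := ltP 0 t; last first.
  by rewrite flat_le0// normr0 mulr_ge0// sqr_ge0.
rewrite /flat t0; set s := t^-1.
have s0 : 0 < s by rewrite invr_gt0.
rewrite ger0_norm ?mulr_ge0 ?exprn_ge0 ?expR_ge0 ?(ltW s0)//.
rewrite expRN ler_pdivrMr ?expR_gt0//.
have := expR_ge1Dxn n.+1 (ltW s0).
have F0 : 0 < n.+2`!%:R :> R by rewrite ltr0n fact_gt0.
have : s ^+ n.+2 = s ^+ n * s ^+ 2 by rewrite -exprD addn2.
move=> -> H; have : s ^+ n * s ^+ 2 <= n.+2`!%:R * expR s.
  rewrite -ler_pdivrMl// mulrC (le_trans _ H)// lerDr//.
have -> : t ^+ 2 = (s ^+ 2)^-1 by rewrite /s exprVn invrK.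
by rewrite mulrAC ler_pdivlMr// exprn_gt0.
Qed.

Lemma flat_is_derive n t : is_derive t 1 (flat n) (flat' n t).
Proof.
have [t0|t0|<-] := ltgtP 0 t.
- apply: (@near_eq_is_derive _ _ _ (fun s : R => s^-1 ^+ n * expR (- s^-1))).
    near=> s; rewrite /flat ifT//; near: s; exact: lt_nbhsr.
  have d1 : is_derive t 1 (fun s : R => s^-1) (- t ^- 2 *: 1).
    by apply: (@is_deriveV _ id); rewrite ?gt_eqF.
  have d2 := is_deriveX n d1.
  have d3 : is_derive t 1 (fun s : R => - s^-1) (- (- t ^- 2 *: 1)).
    exact: is_deriveN d1.
  have d4 := is_derive1_comp (is_derive_expR _) d3.
  have d5 := is_deriveM d2 d4.
  have -> : (fun s : R => s^-1 ^+ n * expR (- s^-1)) =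
      (fun s : R => s^-1) ^+ n * (expR \o (fun s : R => - s^-1)).
    by apply/funext => s; rewrite !fctE.
  apply: (is_derive_eq d5).
  rewrite /flat' /flat t0 /=.
  rewrite /GRing.scale /=.
  have tn0 : t != 0 by rewrite gt_eqF.
  move: (expR _) => e; case: n d2 d5 => [|m] _ _ /=;
    rewrite ?fctE ?expr0 ?mul0r ?exprS ?exprVn /=.
    by rewrite expr0; field.
  by rewrite expr0; move: (t ^- m) (m.+1%:R : R) => u v; field.
- apply: (@near_eq_is_derive _ _ _ (cst 0)).
    near=> s; rewrite flat_le0//; apply: ltW; near: s; exact: lt_nbhsl.
  by rewrite /flat' !flat_le0 ?ltW// mulr0 subr0; exact: is_derive_cst.
have -> : flat' n 0 = 0 by rewrite /flat' !flat_le0// mulr0 subr0.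
have c : (fun h : R => h^-1 *: ((flat n \o shift 0) (h *: 1) - flat n 0)) @ 0^'
    --> (0 : R).
  apply/cvgr0Pnorm_le => e e0.
  have F0 : 0 < n.+2`!%:R :> R by rewrite ltr0n fact_gt0.
  near=> h.
  rewrite /= addr0 (@flat_le0 n 0)// subr0 /GRing.scale /= mulr1 normrM normfV.
  have h0 : h != 0 by near: h; exact: nbhs_dnbhs_neq.
  rewrite ler_pdivrMl ?normr_gt0// (le_trans (flat_bound n h))//.
  rewrite -[h ^+ 2]ger0_norm ?sqr_ge0// expr2 normrM mulrA [leRHS]mulrC ler_wpM2r//.
  rewrite -ler_pdivlMl// mulrC; near: h; apply: dnbhs0_le; exact: divr_gt0.
by split; [apply/cvg_ex; exists 0|exact: cvg_lim].
Unshelve. all: by end_near. Qed.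

End FlatFunction.

(** The induction on the order of differentiability works for all n at once, as
    the derivative of the n-th function involves the next two. *)
Lemma Ck_flat (R : realType) (E : normedModType R) (O : set E) (g : E -> R^o) k n :
  open O -> Ck_on k O g -> Ck_on k O (fun x => flat n (g x) : R^o).
Proof.
move=> oO; elim: k n g => [|k IH] n g.
  move=> /= Cg x Ox; apply: (@continuous_comp _ _ _ g (flat n)); first exact: Cg.
  have /derivable1_diffP := @ex_derive _ _ _ _ _ _ _ (flat_is_derive n (g x)).
  exact: differentiable_continuous.
move=> /[dup] /CkW Wg [dg Cg].
have df (t : R) : differentiable (flat n : R -> R) t.
  by apply/derivable1_diffP; exact: (@ex_derive _ _ _ _ _ _ _ (flat_is_derive n t)).
split=> [x Ox|v].
  by apply: (@differentiable_comp _ _ _ _ g (flat n)); [exact: dg|exact: df].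
apply: (@Ck_ext _ _ _ _ _ (fun x => ('d g x v : R) * flat' n (g x))) => //.
  move=> x Ox; rewrite [in RHS](diff_comp (dg x Ox) (df _)) /= diff1E//.
  by rewrite derive1E (@derive_val _ _ _ _ _ _ _ (flat_is_derive n (g x))).
apply: CkM => //; first exact: Cg.
apply: CkD => //; first exact: IH.
have -> : (fun x => - (n%:R * flat n.+1 (g x))) = (fun x => (- n%:R) * flat n.+1 (g x)).
  by apply/funext => x; rewrite mulNr.
by apply: CkM => //; [exact: Ck_cst|exact: IH].
Qed.

Section Charts.
Variables (R : realType) (n : nat) (M : topologicalType).
Implicit Type c : chart R n M.

Lemma within_open_preimage (T U : topologicalType) (D : set T) (f : T -> U)
    (O : set U) :
  open D -> {within D, continuous f} -> open O -> open (D `&` f @^-1` O).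
Proof.
move=> oD; rewrite continuous_open_subspace// => cf oO.
rewrite openE => x [Dx Ofx]; apply: filterI; first exact: open_nbhs_nbhs.
by apply: (cf x); [rewrite inE|exact: open_nbhs_nbhs].
Qed.

Lemma chart_open c (O : set M) : open O -> open (ch_cod c `&` ch_inv c @^-1` O).
Proof.
move=> oO; apply: within_open_preimage => //; first exact: ch_cod_open.
exact: ch_inv_cont.
Qed.

Variable X : smooth_structure R n M.

Lemma smooth_map_continuous (W : normedModType R) (O : set M) (f : M -> W) x :
  smooth_map_on X O f -> open O -> O x -> {for x, continuous f}.
Proof.
move=> Cf oO Ox; have [c ac dx] := atlas_cover X x.
pose g := (f \o ch_inv c) \o ch_map c.
have cg : {for x, continuous g}.
  apply: continuous_comp.
    have := @ch_map_cont _ _ _ c; rewrite continuous_open_subspace.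
      by apply; rewrite inE.
    exact: ch_dom_open.
  apply: (Ck_cont (Cf c ac 0%N)); split; first exact: ch_map_cod.
  by rewrite /= ch_mapK.
have gf : \near x, g x = f x.
  near=> y; rewrite /g /= ch_mapK//; near: y.
  by apply: open_nbhs_nbhs; split => //; exact: ch_dom_open.
move: cg; rewrite /prop_for /continuous_at (nbhs_singleton gf).
exact: cvg_trans (near_eq_cvg gf).
Unshelve. all: by end_near. Qed.

End Charts.

Section Bump.
Variables (R : realType) (n : nat) (M : topologicalType).
Variable X : smooth_structure R n M.

(** Positive inside a Euclidean ball: the Euclidean norm is used instead of the
    sup norm because its square is smooth. *)
Definition bump_arg (u0 : 'rV[R]_n) (e : R) (u : 'rV[R]_n) : R :=
  e ^+ 2 - \sum_i (u 0 i - u0 0 i) ^+ 2.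

Lemma Ck_bump_arg (E : normedModType R) k (O : set E) (f : E -> 'rV[R]_n) u0 e :
  open O -> Ck_on k O f -> Ck_on k O (fun x => bump_arg u0 e (f x) : R^o).
Proof.
move=> oO Cf; apply: CkB => //; first exact: Ck_cst.
apply: Ck_sum => // i _.
have Cd : Ck_on k O (fun x => f x 0 i - u0 0 i : R^o).
  by apply: CkB => //; [exact: Ck_entry|exact: Ck_cst].
exact: (CkM oO Cd Cd).
Qed.

Lemma bump_arg_ge0 u0 e u : 0 < e -> 0 <= bump_arg u0 e u -> `|u - u0| <= e.
Proof.
move=> e0; rewrite subr_ge0 => le_e.
rewrite /Num.norm /= mx_normrE; apply/bigmax_leP.
split=> [|[i j] _ /=]; first exact: ltW.
rewrite ord1 !mxE -ler_sqr ?nnegrE ?(ltW e0)//.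
rewrite real_normK ?num_real// (le_trans _ le_e)//.
by rewrite (bigD1 j)//= lerDl sumr_ge0// => k _; exact: sqr_ge0.
Qed.

Variables (c0 : chart R n M) (u0 : 'rV[R]_n) (e : R).

Definition bump_fun (x : M) : R :=
  if `[< ch_dom c0 x >] then flat 0 (bump_arg u0 e (ch_map c0 x)) else 0.

Definition bump_supp : set M := ch_inv c0 @` [set u | `|u - u0| <= e].

Definition bump_core : set M :=
  [set x | ch_dom c0 x /\ 0 < bump_arg u0 e (ch_map c0 x)].

Lemma bump_neq0 x : (bump_fun x != 0) = `[< bump_core x >].
Proof.
rewrite /bump_fun; case: asboolP => d; last first.
  by rewrite eqxx; apply/esym/asboolP => -[].
by rewrite flat_gt0; apply/idP/asboolP => [|[]//].
Qed.

Lemma bump_core_supp x : 0 < e -> bump_core x -> bump_supp x.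
Proof.
move=> e0 [dx g0]; exists (ch_map c0 x); last exact: ch_mapK.
by apply: bump_arg_ge0 => //; exact: ltW.
Qed.

Lemma open_bump_core : open bump_core.
Proof.
have -> : bump_core = ch_dom c0 `&` ch_map c0 @^-1` [set u | 0 < bump_arg u0 e u] by [].
apply: within_open_preimage; [exact: ch_dom_open|exact: ch_map_cont|].
have Ca : Ck_on 0 setT (fun u => bump_arg u0 e u : R^o).
  by apply: Ck_bump_arg; [exact: openT|exact: Ck_id].
rewrite (_ : [set u | _] = (fun u => bump_arg u0 e u : R^o) @^-1` [set t | 0 < t]) //.
by apply: open_comp; [move=> u _; exact: Ca|exact: open_gt].
Qed.

(** The support is the image of a compact set, hence closed since M is
    Hausdorff; this is what lets objects supported there be extended by 0. *)
Lemma bump_supp_closed : [set u | `|u - u0| <= e] `<=` ch_cod c0 -> closed bump_supp.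
Proof.
move=> sub; apply: compact_closed; first exact: sm_hausdorff X.
apply: continuous_compact.
  by apply: continuous_subspaceW sub _; exact: ch_inv_cont.
apply: bounded_closed_compact.
  exists (e + `|u0|); split; first exact: num_real.
  move=> r er u /= ue; rewrite -(subrK u0 u) (le_trans (ler_normD _ _))//.
  by rewrite (le_trans _ (ltW er))// lerD2r.
have -> : [set u | `|u - u0| <= e] = closed_ball_ Num.norm u0 e.
  by apply/seteqP; split => u; rewrite /closed_ball_ /= distrC.
exact: closed_closed_ball_.
Qed.

Lemma Ck_bump (c : chart R n M) k : atlas X c0 -> atlas X c ->
  Ck_on k (ch_cod c `&` ch_inv c @^-1` ch_dom c0)
    (fun u => bump_fun (ch_inv c u) : R^o).
Proof.
move=> ac0 ac; have oO : open (ch_cod c `&` ch_inv c @^-1` ch_dom c0).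
  by apply: chart_open; exact: ch_dom_open.
apply: (@Ck_ext _ _ _ _ _
  (fun u => flat 0 (bump_arg u0 e ((ch_map c0 \o ch_inv c) u)) : R^o)) => //.
  by move=> u [_ du]; rewrite /bump_fun; case: asboolP.
by apply: Ck_flat => //; apply: Ck_bump_arg => //; exact: (atlas_compat ac ac0).
Qed.

End Bump.

(** * Smoothness of the structure constants *)

Section Fibres.
Variables (R : realType) (r : nat) (M : topologicalType) (V : M -> lmodType R).
Variable t : local_triv r V.
Variables (x : M) (tx : lt_dom t x).

Lemma lt_mapD v w : lt_map t (v + w : V x) = lt_map t v + lt_map t w.
Proof. by rewrite -[v]scale1r (lt_linear tx) !scale1r. Qed.

Lemma lt_map0 : lt_map t (0 : V x) = 0.
Proof. by apply: (addrI (lt_map t (0 : V x))); rewrite -lt_mapD !addr0. Qed.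

Lemma lt_mapZ k v : lt_map t (k *: v : V x) = k *: lt_map t v.
Proof. by rewrite -[k *: v]addr0 (lt_linear tx) lt_map0 addr0. Qed.

Lemma lt_mapB v w : lt_map t (v - w : V x) = lt_map t v - lt_map t w.
Proof. by rewrite lt_mapD -scaleN1r lt_mapZ scaleN1r. Qed.

Lemma lt_inv_linear : linear (@lt_inv _ _ _ _ t x).
Proof.
move=> k v w; apply: (can_inj (lt_mapK tx)).
by rewrite lt_mapD lt_mapZ !(lt_invK tx).
Qed.

Lemma lt_inv_sum w : lt_inv t x w = \sum_i w 0 i *: lt_inv t x (delta_mx 0 i).
Proof.
pose iM := GRing.isLinear.Build _ _ _ _ _ lt_inv_linear.
pose iL : {linear _ -> _} := HB.pack (@lt_inv _ _ _ _ t x) iM.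
rewrite {1}(row_sum_delta w) -[LHS]/(iL _) linear_sum; apply: eq_bigr => i _.
by rewrite linearZ.
Qed.

Lemma lt_map_sum I (s : seq I) (f : I -> V x) :
  lt_map t (\sum_(i <- s) f i) = \sum_(i <- s) lt_map t (f i).
Proof.
elim: s => [|i s IH]; first by rewrite !big_nil lt_map0.
by rewrite !big_cons lt_mapD IH.
Qed.

End Fibres.

Section StructureConstants.
Variables (R : realType) (n r : nat) (M : topologicalType).
Variables (X : smooth_structure R n M) (V : vector_bundle X r) (C : na_courant V).
Variable t : local_triv r V.

Definition fibre_bil x (a b : 'rV[R]_r) : 'rV[R]_r :=
  lt_map t (na_fiber C x (lt_inv t x a) (lt_inv t x b)).

Definition fibre_mx x : 'M[R]_(r * r, r) := mx_of_bil (fibre_bil x).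

Lemma fibre_mxE x a b : lt_dom t x -> bil (fibre_mx x) a b = fibre_bil x a b.
Proof.
move=> tx; have fb : bilinear_for
    (GRing.Scale.Law.clone _ _ *:%R _) (GRing.Scale.Law.clone _ _ *:%R _) (fibre_bil x).
  split=> [w|w] k u v; rewrite /fibre_bil (lt_inv_linear tx).
    by rewrite linearPl lt_mapD// lt_mapZ.
  by rewrite linearPr lt_mapD// lt_mapZ.
pose fM := bilinear_isBilinear.Build R _ _ _ _ _ (fibre_bil x) fb.
pose fB : {bilinear _ -> _ -> _} := HB.pack (fibre_bil x) fM.
exact: (mx_of_bilE fB).
Qed.

Lemma fibre_mx_kv x : lt_dom t x -> kv_mx (fibre_mx x).
Proof.
move=> tx a b c; rewrite /assoc_defect !fibre_mxE// /fibre_bil !(lt_mapK tx).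
by rewrite -!lt_mapB// kv_law.
Qed.

End StructureConstants.

Section CutoffSections.
Variables (R : realType) (n r : nat) (M : topologicalType).
Variables (X : smooth_structure R n M) (V : vector_bundle X r) (C : na_courant V).
Variables (t : local_triv r V) (c0 : chart R n M) (u0 : 'rV[R]_n) (e : R).
Hypothesis at_ : vb_atlas t.
Hypothesis ac0 : atlas X c0.
Hypothesis e0 : 0 < e.
Hypothesis ball_sub :
  [set u | `|u - u0| <= e] `<=` ch_cod c0 `&` ch_inv c0 @^-1` lt_dom t.

Let rho := bump_fun c0 u0 e.
Let K := bump_supp c0 u0 e.

Definition cutoff_section (w : 'rV[R]_r) (x : M) : V x := rho x *: lt_inv t x w.

Let K_closed : closed K.
Proof. by apply: (bump_supp_closed X) => u /ball_sub[]. Qed.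

Let K_sub x : K x -> lt_dom t x.
Proof. by case=> u /ball_sub[_ tu] <-. Qed.

Lemma bump_core_triv x : bump_core c0 u0 e x -> lt_dom t x.
Proof. by move=> /(bump_core_supp e0); exact: K_sub. Qed.

Let rho0 x : ~ K x -> rho x = 0.
Proof.
move=> nK; apply/eqP/negPn/negP; rewrite bump_neq0 => /asboolP.
by move=> /(bump_core_supp e0).
Qed.

(** The domain of any trivialization is covered by two open sets, the part inside
    the domains of t and c0, where the section is a product of smooth maps, and
    the complement of the support, where it is 0. *)
Lemma cutoff_section_smooth w : smooth_section (cutoff_section w).
Proof.
move=> s as_ c ac k.
have os := lt_dom_open s; have ot := lt_dom_open t; have o0 := ch_dom_open c0.
pose O1 := ch_cod c `&` ch_inv c @^-1` (lt_dom t `&` lt_dom s `&` ch_dom c0).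
pose O2 := ch_cod c `&` ch_inv c @^-1` (lt_dom s `&` ~` K).
have oO1 : open O1 by apply: chart_open; apply: openI => //; exact: openI.
have oO2 : open O2 by apply: chart_open; apply: openI => //; exact: closed_openC.
apply: (@Ck_subset _ _ _ _ (O1 `|` O2)).
  move=> u [cu su]; have [Ku|nKu] := pselect (K (ch_inv c u)); last by right.
  left; split=> //; split; first by split => //; exact: K_sub.
  by have [v /ball_sub[cv _] <-] := Ku; exact: ch_inv_dom.
apply: CkU.
  apply: (@Ck_ext _ _ _ _ _ (fun u => (rho (ch_inv c u)) *:
      lt_map s (lt_inv t (ch_inv c u) w))) => //.
    by move=> u [_ [[tu su] _]]; rewrite /= /cutoff_section lt_mapZ.
  apply: CkZ => //.
    by apply: Ck_subset (Ck_bump u0 e k ac0 ac) => u [cu [_ du]].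
  by apply: Ck_subset (vb_compat at_ as_ w ac k) => u [cu [[tu su] _]].
apply: (@Ck_ext _ _ _ _ _ (fun=> 0)) => //; last exact: Ck_cst.
by move=> u [_ [su nK]]; rewrite /= /cutoff_section rho0// scale0r lt_map0.
Qed.

(** The product of the cut-off sections i and j is a global smooth section, equal
    to the square of the bump function times the product of the frame vectors i
    and j. *)
Lemma fibre_mx_smooth : smooth_map_on X (bump_core c0 u0 e) (fibre_mx C t).
Proof.
move=> c ac k; set O := _ `&` _.
have oO : open O by apply: chart_open; exact: open_bump_core.
have Ot u : O u -> lt_dom t (ch_inv c u) by move=> [_ /bump_core_triv].
have Orho u : O u -> rho (ch_inv c u) != 0.
  by move=> [_ cu]; rewrite bump_neq0; exact/asboolP.
have Crho : Ck_on k O (fun u => rho (ch_inv c u) : R^o).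
  by apply: Ck_subset (Ck_bump u0 e k ac0 ac) => u [cu []].
have Crho' : Ck_on k O (fun u => (rho (ch_inv c u) : R)^-1 : R^o) by exact: CkV.
apply: Ck_sum => // i _; apply: Ck_sum => // j _.
apply: Ck_mulmx => //; first exact: Ck_cst.
pose s := cutoff_section (delta_mx 0 i); pose s' := cutoff_section (delta_mx 0 j).
have Cs : smooth_section s by exact: cutoff_section_smooth.
have Cs' : smooth_section s' by exact: cutoff_section_smooth.
have Cm := na_mul_smooth C Cs Cs' at_ ac k.
apply: (@Ck_ext _ _ _ _ _ (fun u => (rho (ch_inv c u))^-1 *: ((rho (ch_inv c u))^-1 *:
   lt_map t (na_mul C s s' (ch_inv c u))))) => //.
  move=> u Ou; rewrite -na_fiberE// /s /s' /cutoff_section.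
  rewrite linearZl_LR linearZr_LR /= !lt_mapZ ?scalerA; try exact: Ot.
  have := Orho u Ou; move: (rho _) => q q0.
  by rewrite (_ : q^-1 / q * (q * q) = 1) ?scale1r//; field.
apply: CkZ => //; apply: CkZ => //.
by apply: Ck_subset Cm => u Ou; split; [by case: Ou|exact: Ot].
Qed.

End CutoffSections.

(** * Local triviality *)

Lemma cocycle_rearrange (R : realType) k (A B P Q A' B' P' Q' : 'rV[R]_k) :
  A + P - Q - B = A' + P' - Q' - B' -> A - B - P' + Q' = A' - B' - P + Q.
Proof.
by move=> /rowP E; apply/rowP => j; move: (E j); rewrite !mxE; lra.
Qed.

Section FibreRigidity.
Variables (R : realType) (n r : nat) (M : topologicalType).
Variables (X : smooth_structure R n M) (V : vector_bundle X r) (C : na_courant V).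
Variables (t : local_triv r V) (x : M).
Hypothesis tx : lt_dom t x.

(** The hypothesis on H^2 of the fibre, transported to R^r: the 1-cochain that
    bounds Y is the matrix H. *)
Lemma fibre_mx_cobounds : H2_eq0 (na_fiber C x) ->
  forall Y, (forall a b c,
    twisted_cocycle (fibre_mx C t x) (fibre_mx C t x) 1%:M Y a b c = 0) ->
  exists H, Y = defect_d1 (fibre_mx C t x) H.
Proof.
move=> H2 Y Yc; pose m := @lt_map _ _ _ _ t x; pose i := @lt_inv _ _ _ _ t x.
have mK : cancel m i := lt_mapK tx; have iK : cancel i m := lt_invK tx.
have il : linear i := lt_inv_linear tx; have ml : linear m := lt_linear tx.
pose f v w := i (bil Y (m v) (m w)).
have muE v w : m (na_fiber C x v w) = bil (fibre_mx C t x) (m v) (m w).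
  by rewrite fibre_mxE// /fibre_bil /m !(lt_mapK tx).
have [||v w z|phi phil phiE] := H2_eq0_cobounds (f := f) H2.
- by move=> w k u v; rewrite /f ml linearPl il.
- by move=> w k u v; rewrite /f ml linearPr il.
- have := Yc (m v) (m w) (m z); rewrite /twisted_cocycle /half_cocycle !mulmx1 => /eqP.
  rewrite subr_eq0 => /eqP E; apply: (can_inj mK).
  rewrite /m !(lt_mapB, lt_mapD)// -/m /f !muE !iK.
  exact: cocycle_rearrange E.
have pl : linear (m \o phi \o i) by move=> k u v; rewrite /= il phil ml.
pose pM := GRing.isLinear.Build _ _ _ _ (m \o phi \o i) pl.
pose pL : {linear _ -> _} := HB.pack (m \o phi \o i) pM.
exists (lin1_mx pL); apply: bil_ext => a b.
rewrite /defect_d1 !bilD !bilN bil_mulmx !pullE !mulmx1 !mul_rV_lin1 /=.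
have := congr1 m (phiE (i a) (i b)); rewrite /f iK !iK => ->.
rewrite /m !lt_mapB// -/m !muE !iK.
have {1}-> : bil (fibre_mx C t x) a b = m (na_fiber C x (i a) (i b)) by rewrite muE !iK.
by rewrite mK addrAC.
Qed.

End FibreRigidity.

Theorem theorem7p5 (R : realType) (n r : nat) (M : topologicalType)
    (X : smooth_structure R n M) (V : vector_bundle X r) (C : na_courant V)
    (M_connected : connected [set: M])
    (H2_fibers : forall x : M, H2_eq0 (na_fiber C x)) :
  locally_trivial C.
Proof.
move=> x0.
have [c0 ac0 cx0] := atlas_cover X x0.
have [t vt tx0] := vb_cover V x0.
pose u0 := ch_map c0 x0.
have cu0 : ch_cod c0 u0 by exact: ch_map_cod.
have [e e0 ball_sub] : exists2 e : R, 0 < e &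
    [set u | `|u - u0| <= e] `<=` ch_cod c0 `&` ch_inv c0 @^-1` lt_dom t.
  have : nbhs u0 (ch_cod c0 `&` ch_inv c0 @^-1` lt_dom t).
    apply: open_nbhs_nbhs; split; last by split => //; rewrite /= ch_mapK.
    by apply: chart_open; exact: lt_dom_open.
  (* Half the radius, so that the closed ball fits. *)
  move=> /nbhs_ballP[e /= e0 sub]; exists (e / 2); first exact: divr_gt0.
  move=> u /= ue; apply: sub; rewrite -ball_normE /= distrC (le_lt_trans ue)//.
  by rewrite ltr_pdivrMr// ltr_pMr// ltr1n.
pose U1 := bump_core c0 u0 e.
have U1t x : U1 x -> lt_dom t x by exact: (bump_core_triv e0 ball_sub).
have U1x0 : U1 x0.
  split=> //; rewrite /bump_arg big1 ?subr0 ?exprn_gt0// => i _.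
  by rewrite subrr expr0n.
have oU1 : open U1 by exact: open_bump_core.
have Mu_smooth : smooth_map_on X U1 (fibre_mx C t).
  exact: (fibre_mx_smooth C vt ac0 e0 ball_sub).
pose Mu0 := fibre_mx C t x0.
have [eps eps0 [hf [hfU hfE hfS]]] := rigid_product (fibre_mx_kv C tx0)
  (fibre_mx_cobounds tx0 (H2_fibers x0)).
pose d x : 'rV[R]_(r * r * r) := mxvec (fibre_mx C t x - Mu0).
have d_smooth : smooth_map_on X U1 d.
  move=> c ac k; have oO : open (ch_cod c `&` ch_inv c @^-1` U1) by exact: chart_open.
  apply: (@Ck_mxlin _ _ _ oO _ _ _ _
    (mxvec : {linear 'M[R]_(r * r, r) -> 'rV[R]_(r * r * r)})).
  by apply: CkB => //; [exact: Mu_smooth|exact: Ck_cst].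
pose U := U1 `&` [set x | `|d x| < eps].
have oU : open U.
  rewrite openE => x [U1x dx]; apply: filterI; first exact: open_nbhs_nbhs.
  have cd := smooth_map_continuous d_smooth oU1 U1x.
  exact: (cvgr_norm_lt _ cd).
have Ut x : U x -> lt_dom t x by move=> [/U1t].
pose h x := hf (d x).
have hU x : U x -> h x \in unitmx by move=> [_ /hfU].
have dE x : Mu0 + vec_mx (d x) = fibre_mx C t x by rewrite mxvecK addrC subrK.
have hE x a b : U x -> bil (fibre_mx C t x) a b *m h x = bil Mu0 (a *m h x) (b *m h x).
  move=> [U1x dx]; have := hfE _ dx; rewrite dE => /(_ (fibre_mx_kv C (U1t _ U1x))) H.
  by apply/eqP; rewrite -subr_eq0 -morphism_defectE H bil0.
have h_smooth c k : atlas X c ->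
    Ck_on k (ch_cod c `&` ch_inv c @^-1` U) (h \o ch_inv c).
  move=> ac; apply: (hfS _ _ (d \o ch_inv c)).
  - exact: chart_open.
  - by move=> j; apply: Ck_subset (d_smooth c ac j) => u [cu []].
  - by move=> u [_ []].
pose smap x (v : V x) : 'rV[R]_r := lt_map t v *m h x.
pose sinv x (w : 'rV[R]_r) : V x := lt_inv t x (w *m invmx (h x)).
have s_linear x : U x -> linear (@smap x).
  by move=> Ux k v w; rewrite /smap (lt_linear (Ut x Ux)) mulmxDl scalemxAl.
have s_mapK x : U x -> cancel (@smap x) (@sinv x).
  by move=> Ux v; rewrite /sinv /smap mulmxK ?hU// (lt_mapK (Ut x Ux)).
have s_invK x : U x -> cancel (@sinv x) (@smap x).
  by move=> Ux w; rewrite /sinv /smap (lt_invK (Ut x Ux)) mulmxKV ?hU.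
pose s : local_triv r V := LocalTriv oU s_linear s_mapK s_invK.
pose A0 : {bilinear 'rV[R]_r -> 'rV[R]_r -> 'rV[R]_r} := bil Mu0.
have A0_kv a b c : A0 a (A0 b c) - A0 (A0 a b) c = A0 b (A0 a c) - A0 (A0 b a) c.
  exact: (fibre_mx_kv C tx0).
exists s, (KVAlgebra A0_kv); split.
- split=> //; rewrite /= /d subrr linear0 normr0 //.
- move=> t' vt'; split=> w c ac k /=.
  + have oO : open (ch_cod c `&` ch_inv c @^-1` (lt_dom t' `&` U)).
      by apply: chart_open; apply: openI => //; exact: lt_dom_open.
    have C1 := Ck_subset _ (vb_compat vt' vt w ac k).
    have C2 := Ck_subset _ (h_smooth c k ac).
    apply: (Ck_mulmx oO (C1 _ _) (C2 _ _)).
      by move=> u [cu [t'u /Ut]].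
    by move=> u [cu []].
  + set O := ch_cod c `&` _.
    have oO : open O.
      by apply: chart_open; apply: openI => //; exact: lt_dom_open.
    pose wi u := w *m invmx (h (ch_inv c u)).
    have Cw : Ck_on k O wi.
      apply: Ck_mulmx => //; first exact: Ck_cst.
      apply: Ck_invmx => //; first by move=> u [_ [/hU]].
      by apply: Ck_subset (h_smooth c k ac) => u [cu []].
    (* Both trivializations are linear on fibres, so the image of a moving vector
       is expanded on the images of the fixed frame vectors. *)
    apply: (@Ck_ext _ _ _ _ _ (fun u => \sum_i wi u 0 i *:
        lt_map t' (lt_inv t (ch_inv c u) (delta_mx 0 i)))) => //.
      move=> u [_ [/Ut tu t'u]]; rewrite /= /sinv -/(wi u) (lt_inv_sum tu) lt_map_sum//.
      by apply: eq_bigr => i _; rewrite lt_mapZ.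
    apply: Ck_sum => // i _; apply: CkZ => //; first exact: Ck_entry.
    by apply: Ck_subset (vb_compat vt vt' (delta_mx 0 i) ac k) => u [cu [/Ut tu t'u]].
- move=> y Uy v w; rewrite /= /smap /A0 /=.
  have ty := Ut y Uy; rewrite -hE// fibre_mxE// /fibre_bil.
  by rewrite !(lt_mapK ty).
Qed.
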